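(* Let $n=2$, $A_o=\begin{pmatrix}0&0\\0&0\end{pmatrix}$, $B_o=\begin{pmatrix}1&0\\0&0\end{pmatrix}$, and let $\nabla^o$ be the connection on the trivial rank 2 bundle on $\mathbb P^1$ with matrix of connection 1-forms $\Omega_o=-\left(A_o+\frac1zB_o\right)\mathrm dz$. Then there exist no $\mathfrak I_{\rm d}^{\rm gen}(\nabla^o)$-versal integrable deformations of $\nabla^o$.
   Context: Conventions. A connection with matrix of connection 1-forms $\Omega$ in a basis of sections is $\nabla=\mathrm d+\Omega$; a change of basis $G$ replaces $\Omega$ by $G^{-1}\Omega G+G^{-1}\mathrm dG$. All deformations are considered as germs at the base point. Integrable deformations. Let $E^o$ be the trivial bundle carrying $\nabla^o$. An integrable deformation $(\nabla,E,X,x_o)$ of $(E^o,\nabla^o)$ consists of a connected complex manifold $X$, a point $x_o\in X$, a holomorphic vector bundle $E$ on $D\times X$ ($D\subseteq\mathbb P^1$ a disc centered at $z=\infty$), and a flat meromorphic connection $\nabla$ on $E$ with a pole of order 2 along $\{\infty\}\times X$, such that $(E,\nabla)$ restricts to $(E^o,\nabla^o)$ at $x_o$. It is a known fact that, if $X$ is simply connected (always the case after shrinking $X$), there are an analytic hypersurface $\Theta\subseteq X\setminus\{x_o\}$ and a unique basis of sections (meromorphic along $D\times \Theta$) with respect to which $\nabla$ has matrix $$\Omega(z,x)=-\left(A(x)+\tfrac1zB_o\right)\mathrm dz-z\,C(x),\qquad x\in X\setminus\Theta,$$ with $A$ a holomorphic matrix function and $C$ a matrix of holomorphic 1-forms on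 $X\setminus\Theta$ (meromorphic along $\Theta$), $A(x_o)=A_o$, $C(x_o)=0$. The integrability condition is: $\mathrm dC=0$, $C\wedge C=0$, $[A,C]=0$, $\mathrm dA=C+[C,B_o]$. $\mathfrak I_{\rm d}^{\rm gen}(\nabla^o)$ is the class of germs of integrable deformations of generic d-type: $A$ and $C$ are locally holomorphically diagonalizable at $x_o$ (conjugate to diagonal by a holomorphic invertible matrix defined near $x_o$) and the holomorphic eigenvalues $f_1,f_2$ of $A$ near $x_o$ satisfy $\mathrm d_{x_o}f_1\neq\mathrm d_{x_o}f_2$. For a class $\mathfrak I$ of integrable deformations of $\nabla^o$, a deformation $(\nabla,E,X,x_o)$ is $\mathfrak I$-versal if it is an element of $\mathfrak I$ and any element $(\nabla',E',X',x_o')$ of $\mathfrak I$ is induced by it via pull-back along a (germ of) holomorphic base-change map $\phi\colon(X',x_o')\to(X,x_o)$. *)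

(* Defs.v *)
From HB Require Import structures.
From mathcomp Require Import all_boot all_order all_algebra.
From mathcomp Require Import complex.
From mathcomp Require Import boolp classical_sets reals topology normedtype.
From mathcomp Require Import derive.

Set Implicit Arguments.
Unset Strict Implicit.
Unset Printing Implicit Defensive.

Import Order.TTheory GRing.Theory Num.Theory.
Import numFieldNormedType.Exports.

Local Open Scope classical_set_scope.
Local Open Scope complex_scope.
Local Open Scope ring_scope.

(* Complex numbers as a normed module over themselves: [differentiable] and ['d]
   are then complex differentiability and the complex-linear differential. *)
Notation cplx R := ((R[i])^o).
Notation cspace R m := ('rV[cplx R]_m).
(* Points (w, x) with w = 1/z, so that {z = oo} is {w = 0}. *)
Notation wspace R m := (cplx R * cspace R m)%type.
Notation cmx R n := ('M[cplx R]_n).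

(* Only used on open sets U. *)
Definition holo (R : realType) (V W : normedModType R[i]) (U : set V)
    (f : V -> W) : Prop :=
  forall p, U p -> differentiable f p.

Definition holo_unit (R : realType) (n : nat) (V : normedModType R[i])
    (U : set V) (g : V -> cmx R n) : Prop :=
  holo U g /\ forall p, U p -> g p \in unitmx.

(* A matrix of 1-forms is a map omega p v (point p, tangent vector v). *)
Definition holo_form (R : realType) (n : nat) (V : normedModType R[i])
    (U : set V) (omega : V -> V -> cmx R n) : Prop :=
  (forall p, U p -> forall (a : R[i]) (u v : V),
     omega p (a *: u + v) = a *: omega p u + omega p v) /\
  (forall v, holo U (fun p => omega p v)).

(* (d omega)(u, v) for constant vector fields u, v. *)
Definition dform (R : realType) (n : nat) (V : normedModType R[i])
    (omega : V -> V -> cmx R n) (p u v : V) : cmx R n :=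
  'd (fun q => omega q v) p u - 'd (fun q => omega q u) p v.

Definition wedge (R : realType) (n : nat) (V : normedModType R[i])
    (omega : V -> V -> cmx R n) (p u v : V) : cmx R n :=
  omega p u *m omega p v - omega p v *m omega p u.

Definition gauge (R : realType) (n : nat) (V : normedModType R[i])
    (G : V -> cmx R n) (omega : V -> V -> cmx R n) (p v : V) : cmx R n :=
  invmx (G p) *m omega p v *m G p + invmx (G p) *m 'd G p v.

Definition pole2 (R : realType) (n m : nat)
    (M : wspace R m -> wspace R m -> cmx R n) (p v : wspace R m) : cmx R n :=
  p.1 ^- 2 *: M p v.

(* A holomorphic vector bundle of rank n on S, given by local frames e_i on
   cb_dom i with e_j = e_i g_ij, where g = cb_trans.  The matrix of the
   connection in the frame e_i is w^-2 times the holomorphic matrix of 1-forms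
   cb_polar i. *)
Record conn_bundle (R : realType) (n m : nat) (S : set (wspace R m)) := ConnBundle {
  cb_idx : Type;
  cb_dom : cb_idx -> set (wspace R m);
  cb_trans : cb_idx -> cb_idx -> wspace R m -> cmx R n;
  cb_polar : cb_idx -> wspace R m -> wspace R m -> cmx R n;
  cb_dom_open : forall i, open (cb_dom i);
  cb_cover : forall p, S p <-> exists i, cb_dom i p;
  cb_trans_holo : forall i j,
    holo_unit (cb_dom i `&` cb_dom j) (cb_trans i j);
  cb_cocycle : forall i j k p, cb_dom i p -> cb_dom j p -> cb_dom k p ->
    cb_trans i j p *m cb_trans j k p = cb_trans i k p;
  cb_polar_holo : forall i, holo_form (cb_dom i) (cb_polar i);
  cb_compat : forall i j p v, cb_dom i p -> cb_dom j p -> p.1 != 0 ->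
    pole2 (cb_polar j) p v = gauge (cb_trans i j) (pole2 (cb_polar i)) p v;
  cb_flat : forall i p u v, cb_dom i p -> p.1 != 0 ->
    dform (pole2 (cb_polar i)) p u v + wedge (pole2 (cb_polar i)) p u v = 0
}.

Definition cb_conn (R : realType) (n m : nat) (S : set (wspace R m))
    (E : conn_bundle n S) (i : cb_idx E) : wspace R m -> wspace R m -> cmx R n :=
  pole2 (cb_polar i).

(* A basis of sections of E over an open subset U of S, written e_i s_i in the
   local frames, in which the connection has matrix Omega. *)
Definition basis_with_matrix (R : realType) (n m : nat) (S : set (wspace R m))
    (E : conn_bundle n S) (U : set (wspace R m))
    (s : cb_idx E -> wspace R m -> cmx R n)
    (Omega : wspace R m -> wspace R m -> cmx R n) : Prop :=
  [/\ forall i, holo_unit (cb_dom i `&` U) (s i),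
      forall i j p, cb_dom i p -> cb_dom j p -> U p ->
        cb_trans i j p *m s j p = s i p
    & forall i p v, cb_dom i p -> U p -> p.1 != 0 ->
        gauge (s i) (cb_conn i) p v = Omega p v].

(* The form dz for z = 1/w. *)
Definition dz (R : realType) (w u : cplx R) : cplx R := - (w ^- 2 * u).

(* - (A_o + B_o / z) dz, in the coordinate w = 1/z. *)
Definition Omega_o (R : realType) (n : nat) (Ao Bo : cmx R n)
    (w u : cplx R) : cmx R n :=
  - (dz w u *: (Ao + w *: Bo)).

Definition slice_basis_with_matrix (R : realType) (n m : nat)
    (S : set (wspace R m)) (E : conn_bundle n S) (xo : cspace R m)
    (h : cb_idx E -> cplx R -> cmx R n)
    (Omega : cplx R -> cplx R -> cmx R n) : Prop :=
  [/\ forall i, holo_unit [set w | cb_dom i (w, xo)] (h i),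
      forall i j w, cb_dom i (w, xo) -> cb_dom j (w, xo) ->
        cb_trans i j (w, xo) *m h j w = h i w
    & forall i (w u : cplx R), cb_dom i (w, xo) -> w != 0 ->
        gauge (h i) (fun t (v : cplx R) => cb_conn i (t, xo) (v, 0)) w u
        = Omega w u].

Definition disc (R : realType) (r : R) : set (cplx R) :=
  [set w | `|w| < r%:C].

(* Deformations are germs at the base point, so X is taken inside a coordinate
   chart.  The identification of the restriction of (E, nabla) to D x {xo} with
   (E^o, nabla^o) is part of the data: it is the basis id_basis of the
   restriction corresponding to the canonical basis of the trivial bundle E^o. *)
Record int_deformation (R : realType) (n : nat) (Ao Bo : cmx R n) :=
    IntDeformation {
  id_dim : nat;
  id_X : set (cspace R id_dim);
  id_xo : cspace R id_dim;
  id_r : R;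
  id_E : conn_bundle n (disc id_r `*` id_X);
  id_basis : cb_idx id_E -> cplx R -> cmx R n;
  id_open : open id_X;
  id_connected : connected id_X;
  id_base : id_X id_xo;
  id_r_gt0 : 0 < id_r;
  id_restr : slice_basis_with_matrix id_xo id_basis (Omega_o Ao Bo)
}.

Arguments id_X {R n Ao Bo} i _.

(* - (A + B_o / z) dz - z C, in the coordinate w = 1/z. *)
Definition normal_matrix (R : realType) (n m : nat) (Bo : cmx R n)
    (A : cspace R m -> cmx R n) (C : cspace R m -> cspace R m -> cmx R n)
    (p v : wspace R m) : cmx R n :=
  - (dz p.1 v.1 *: (A p.2 + p.1 *: Bo)) - p.1^-1 *: C p.2 v.2.

(* The polar locus Theta does not contain xo, so it disappears in the germ at
   xo.  That the 1-form C restricts to 0 at the point xo imposes no condition;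
   its coefficients need not vanish at xo. *)
Definition normal_form (R : realType) (n : nat) (Ao Bo : cmx R n)
    (d : int_deformation Ao Bo) (U : set (cspace R (id_dim d)))
    (A : cspace R (id_dim d) -> cmx R n)
    (C : cspace R (id_dim d) -> cspace R (id_dim d) -> cmx R n) : Prop :=
  [/\ [/\ open U, U (id_xo d) & U `<=` id_X d],
      [/\ holo U A, holo_form U C & A (id_xo d) = Ao],
      exists s : cb_idx (id_E d) -> wspace R (id_dim d) -> cmx R n,
        basis_with_matrix (disc (id_r d) `*` U) s (normal_matrix Bo A C) /\
        (forall i w, cb_dom i (w, id_xo d) -> s i (w, id_xo d) = id_basis i w)
    & forall x, U x ->
        [/\ forall u v, dform C x u v = 0,
            forall u v, wedge C x u v = 0,
            forall v, A x *m C x v - C x v *m A x = 0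
          & forall v, 'd A x v = C x v + (C x v *m Bo - Bo *m C x v)]].

Definition generic_dtype (R : realType) (n : nat) (Ao Bo : cmx R n)
    (d : int_deformation Ao Bo) : Prop :=
  exists (U : set (cspace R (id_dim d)))
         (A : cspace R (id_dim d) -> cmx R n)
         (C : cspace R (id_dim d) -> cspace R (id_dim d) -> cmx R n),
  [/\ normal_form U A C,
      exists (P : cspace R (id_dim d) -> cmx R n)
             (f : 'I_n -> cspace R (id_dim d) -> cplx R),
        [/\ holo_unit U P,
            forall i, holo U (f i),
            forall x, U x -> invmx (P x) *m A x *m P x = diag_mx (\row_i f i x)
          & forall i j, i != j ->
              exists v, 'd (f i) (id_xo d) v != 'd (f j) (id_xo d) v]
    & exists Q : cspace R (id_dim d) -> cmx R n,
        holo_unit U Q /\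
        forall x v, U x -> is_diag_mx (invmx (Q x) *m C x v *m Q x)].

Definition base_change (R : realType) (m' m : nat)
    (phi : cspace R m' -> cspace R m) (p : wspace R m') : wspace R m :=
  (p.1, phi p.2).

(* d' is induced by d: near the base point of X' there is an isomorphism
   phi^* (E, nabla) -> (E', nabla') over D x X', compatible with the
   identifications of both sides with (E^o, nabla^o) at the base point.  The
   isomorphism is given by matrices T a i sending the pulled-back frame phi^* e_i
   to e'_a (T a i); the discs D and D' are compared on their intersection. *)
Definition induced (R : realType) (n : nat) (Ao Bo : cmx R n)
    (d' d : int_deformation Ao Bo) : Prop :=
  exists (U : set (cspace R (id_dim d')))
         (phi : cspace R (id_dim d') -> cspace R (id_dim d))
         (T : cb_idx (id_E d') -> cb_idx (id_E d) ->
              wspace R (id_dim d') -> cmx R n),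
  let dom a i := [set p | [/\ U p.2, cb_dom a p & cb_dom i (base_change phi p)]] in
  [/\ [/\ open U, U (id_xo d') & U `<=` id_X d'],
      [/\ holo U phi, phi (id_xo d') = id_xo d
        & forall x, U x -> id_X d (phi x)],
      [/\ forall a i, holo_unit (dom a i) (T a i)
        & forall a b i j p, dom a i p -> dom b j p ->
            T b j p = cb_trans b a p *m T a i p *m
                      cb_trans i j (base_change phi p)],
      forall a i p v, dom a i p -> p.1 != 0 ->
        gauge (T a i) (cb_conn a) p v =
        cb_conn i (base_change phi p) (v.1, 'd phi (p.2) v.2)
    & forall a i w, dom a i (w, id_xo d') ->
        T a i (w, id_xo d') *m id_basis i w = id_basis a w].

Definition versal (R : realType) (n : nat) (Ao Bo : cmx R n)
    (cls : int_deformation Ao Bo -> Prop) (d : int_deformation Ao Bo) : Prop :=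
  cls d /\ forall d', cls d' -> induced d' d.

(* Main.v *)
Require Import Defs.
From HB Require Import structures.
From mathcomp Require Import all_boot all_order all_algebra.
From mathcomp Require Import complex reals.
From mathcomp Require Import boolp classical_sets functions topology normedtype.
From mathcomp Require Import derive realfun landau.
From mathcomp Require Import ring lra.

(* In normal form, [A_o = 0] and the integrability equations make [A] lower
   triangular near the base point, with entries [a], [b], [d], and give
   [(a - d) db = 2 b d(a - d)]: the ratio [b / (a - d)^2] is locally constant.
   Conversely every constant [c] occurs, for instance for the deformation over
   the line with [A = [[x, 0], [c x^2, 0]]].  A base change preserves [c], so no
   single deformation can induce both [c = 0] and [c = 1].

   For the preservation of [c], let [G(w, x)] be the matrix of the isomorphism
   between the model and the pulled-back deformation in their normal bases; it
   is holomorphic at [w = 0] and [G(w, 0) = 1].  For fixed real [x > 0] the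
   [dw]-component of the gauge equation is an ordinary differential equation
   with an irregular singularity at [w = 0], whose bounded solutions are
   explicit: the eigenvalues of the pulled-back [A] are [x] and [0], and the
   lower left entry of [G] is [r(x) (1 - w/x)].  Continuity of [G] at [x = 0]
   for one fixed [w != 0] yields [r(x) = o(x)], and this is exactly what is
   needed for [b = c x^2 + o(x^2)].  Only the [w]-derivative of [G] is used, so
   no theorem on the regularity of holomorphic functions is needed. *)

Set Implicit Arguments.
Unset Strict Implicit.
Unset Printing Implicit Defensive.

Import Order.TTheory GRing.Theory Num.Theory.
Import numFieldNormedType.Exports.

Local Open Scope classical_set_scope.
Local Open Scope complex_scope.
Local Open Scope ring_scope.

(** * Derivatives of complex functions along real lines *)

Local Notation Re := complex.Re.
Local Notation Im := complex.Im.

Lemma ReD (R : realType) (x y : R[i]) : Re (x + y) = Re x + Re y.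
Proof. by case: x; case: y. Qed.
Lemma ImD (R : realType) (x y : R[i]) : Im (x + y) = Im x + Im y.
Proof. by case: x; case: y. Qed.
Lemma ReN (R : realType) (x : R[i]) : Re (- x) = - Re x.
Proof. by case: x. Qed.
Lemma ImN (R : realType) (x : R[i]) : Im (- x) = - Im x.
Proof. by case: x. Qed.
Lemma ReM (R : realType) (x y : R[i]) : Re (x * y) = Re x * Re y - Im x * Im y.
Proof. by case: x; case: y. Qed.
Lemma ImM (R : realType) (x y : R[i]) : Im (x * y) = Re x * Im y + Im x * Re y.
Proof. by case: x; case: y. Qed.

Definition ReImE R := (@ReD R, @ImD R, @ReN R, @ImN R, @ReM R, @ImM R).

Lemma complex_ext (R : realType) (x y : R[i]) : Re x = Re y -> Im x = Im y -> x = y.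
Proof. by case: x => a b; case: y => c d /= -> ->. Qed.

Lemma Re_le_norm (R : realType) (z : R[i]) : `|Re z|%:C <= `|z|.
Proof. exact: normc_ge_Re. Qed.

Lemma Im_le_norm (R : realType) (z : R[i]) : `|Im z|%:C <= `|z|.
Proof.
have := Re_le_norm (z * 'i); rewrite normrM ReM /= mulr0 mulr1 add0r normrN.
by rewrite (normc_def 'i) /= expr0n expr1n add0r sqrtr1 mulr1.
Qed.

Lemma near_dist (K : numFieldType) (V : normedModType K) (z : V) (e : K) : 0 < e ->
  \forall y \near z, `|z - y| < e.
Proof. exact: (@cvgr_dist_lt _ V _ (nbhs z) _ id z (@cvg_id _ _)). Qed.

Lemma Re_continuous (R : realType) : continuous (fun z : cplx R => Re z : R).
Proof.
move=> z; apply/(@cvgrPdist_lt _ _ _ (nbhs z)) => e e0.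
near=> y; rewrite -ltcR (le_lt_trans (_ : _ <= `|z - y|)) //.
  by have := Re_le_norm (z - y); rewrite ReD ReN.
near: y.
by apply: (@near_dist _ (cplx R) z); rewrite ltcR.
Unshelve. all: by end_near. Qed.

Lemma Im_continuous (R : realType) : continuous (fun z : cplx R => Im z : R).
Proof.
move=> z; apply/(@cvgrPdist_lt _ _ _ (nbhs z)) => e e0.
near=> y; rewrite -ltcR (le_lt_trans (_ : _ <= `|z - y|)) //.
  by have := Im_le_norm (z - y); rewrite ImD ImN.
near: y.
by apply: (@near_dist _ (cplx R) z); rewrite ltcR.
Unshelve. all: by end_near. Qed.

Lemma normCR (R : realType) (x : R) : `|x%:C| = `|x|%:C.
Proof. by rewrite normc_def /= expr0n addr0 sqrtr_sqr. Qed.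

Lemma real_complex_continuous (R : realType) :
  continuous (fun x : R => x%:C : cplx R).
Proof.
move=> x; apply/(@cvgrPdist_lt _ _ _ (nbhs x)) => e e0.
(* In [R[i]] the hypothesis [0 < e] forces the imaginary part of [e] to vanish, so the radius is a
   real number in disguise. *)
have eE : e = (Re e)%:C by move: e0; rewrite ltcE => /andP[/eqP/= eI _]; apply: complex_ext.
have Re0 : 0 < Re e by rewrite -ltcR -eE.
near=> y; rewrite -rmorphB normCR eE ltcR.
near: y.
by exact: (@near_dist _ R x).
Unshelve. all: by end_near. Qed.

(** The variable is real and the value complex. Recording the two components separately lets the
    real mean value theorem be applied to each of them. *)
Definition cderiv (R : realType) (f : R -> cplx R) (t : R) (l : cplx R) : Prop :=
  is_derive t 1 (fun x => Re (f x) : R) (Re l) /\ is_derive t 1 (fun x => Im (f x) : R) (Im l).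

Lemma cvg_is_derive (R : realType) (f : R -> R) (t l : R) :
  (fun h : R => h^-1 * (f (h + t) - f t)) @ (0 : R)^' --> l -> is_derive t 1 f l.
Proof.
move=> fl.
have fl' : (fun h : R => h^-1 *: ((f \o shift t) (h *: (1 : R)) - f t)) @ (0 : R)^' --> l.
  apply: cvg_trans fl; apply: near_eq_cvg; near=> h => /=.
  by rewrite /GRing.scale /= mulr1.
apply: DeriveDef; first by apply/cvg_ex; exists l.
exact: cvg_lim.
Unshelve. all: by end_near. Qed.

Lemma cderiv_line (R : realType) (V : normedModType R[i]) (f : V -> cplx R)
    (p v : V) (t : R) :
  differentiable f (p + t%:C *: v) ->
  cderiv (fun s => f (p + s%:C *: v)) t ('d f (p + t%:C *: v) v).
Proof.
move=> fd; set a := p + _.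
have lim1 : (fun h : R[i] => h^-1 *: ((f \o shift a) (h *: v) - f a)) @ (0 : cplx R)^' --> ('d f a v : cplx R).
  rewrite -(deriveE v fd); exact: diff_derivable.
(* The embedding of the reals sends punctured neighbourhoods of 0 into punctured ones, so the
   complex difference quotient may be restricted to real increments. *)
have lim0 : (fun h : R => h%:C : cplx R) @ 0^' --> (0 : cplx R)^'.
  move=> A [e /= e0 Ae].
  have eE : e = (Re e)%:C by move: e0; rewrite ltcE => /andP[/eqP/= eI _]; apply: complex_ext.
  have Re0 : 0 < Re e by rewrite -ltcR -eE.
  exists (Re e) => //= h /=; rewrite sub0r normrN => hR h0.
  apply: Ae => /=.
    by rewrite sub0r normrN normCR eE ltcR.
  by apply: contra_neq h0 => /complexI.

have lim2 : (fun h : R => (h%:C)^-1 * (f (p + (h + t)%:C *: v) - f a)) @ (0 : R)^'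
    --> ('d f a v : cplx R).
  apply: (cvg_trans _ (cvg_comp _ _ lim0 lim1)).
  apply: near_eq_cvg; near=> h => /=.
  by rewrite rmorphD scalerDl addrCA.

have invE (h : R) : (h%:C : cplx R)^-1 = (h^-1)%:C by rewrite fmorphV.
split; apply: cvg_is_derive.
- apply: (cvg_trans _ (cvg_comp _ _ lim2 (@Re_continuous R _))).
  apply: near_eq_cvg; near=> h => /=.
  by rewrite invE !ReImE /= mul0r subr0.
- apply: (cvg_trans _ (cvg_comp _ _ lim2 (@Im_continuous R _))).
  apply: near_eq_cvg; near=> h => /=.
  by rewrite invE !ReImE /= mul0r addr0.
Unshelve. all: by end_near. Qed.

Definition sqn (R : realType) (z : cplx R) : R := Re z ^+ 2 + Im z ^+ 2.

Lemma sqn_ge0 (R : realType) (z : cplx R) : 0 <= sqn z.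
Proof. by rewrite addr_ge0 ?sqr_ge0. Qed.

Lemma sqn_eq0 (R : realType) (z : cplx R) : sqn z = 0 -> z = 0.
Proof.
move=> /eqP; rewrite /sqn paddr_eq0 ?sqr_ge0// !sqrf_eq0 => /andP[/eqP? /eqP?].
exact: complex_ext.
Qed.

Section DerivCalculus.
Context {R : realType}.
Implicit Types (g h : R -> R) (f : R -> cplx R) (t : R).

Lemma is_derive_conv g t (d d' : R) : is_derive t 1 g d -> d = d' -> is_derive t 1 g d'.
Proof. by move=> gd <-. Qed.

Lemma is_derive_funD g h t (dg dh : R) : is_derive t 1 g dg -> is_derive t 1 h dh ->
  is_derive t 1 (fun s => g s + h s) (dg + dh).
Proof. by move=> gd hd; exact: (is_deriveD gd hd). Qed.

Lemma is_derive_funB g h t (dg dh : R) : is_derive t 1 g dg -> is_derive t 1 h dh ->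
  is_derive t 1 (fun s => g s - h s) (dg - dh).
Proof. by move=> gd hd; exact: (is_deriveB gd hd). Qed.

Lemma is_derive_funM g h t (dg dh : R) : is_derive t 1 g dg -> is_derive t 1 h dh ->
  is_derive t 1 (fun s => g s * h s) (dg * h t + g t * dh).
Proof.
by move=> gd hd; rewrite addrC (mulrC dg); exact: (is_deriveM gd hd).
Qed.

Lemma is_derive_sqr t : is_derive t 1 (fun s : R => s ^+ 2) (2 * t).
Proof.
rewrite (_ : (fun s => s ^+ 2) = (fun s => s * s)); last first.
  by apply/funext => s; rewrite expr2.
have -> : 2 * t = 1 * id t + id t * 1 by rewrite mul1r mulr1 mulr_natl mulr2n.
exact: (is_derive_funM (is_derive_id t 1) (is_derive_id t 1)).
Qed.

Lemma cderiv_cst (c : cplx R) t : cderiv (fun=> c) t 0.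
Proof. by split; exact: is_derive_cst. Qed.

Lemma cderiv_real g t (dg : R) : is_derive t 1 g dg ->
  cderiv (fun s => (g s)%:C) t dg%:C.
Proof. by move=> gd; split => //=; exact: is_derive_cst. Qed.

Lemma cderivD f1 f2 t df1 df2 : cderiv f1 t df1 -> cderiv f2 t df2 ->
  cderiv (fun s => f1 s + f2 s) t (df1 + df2).
Proof.
move=> [Rf1 If1] [Rf2 If2]; split.
  by under eq_fun do rewrite ReD; rewrite ReD; exact: is_derive_funD.
by under eq_fun do rewrite ImD; rewrite ImD; exact: is_derive_funD.
Qed.

Lemma cderivM f1 f2 t df1 df2 : cderiv f1 t df1 -> cderiv f2 t df2 ->
  cderiv (fun s => f1 s * f2 s) t (df1 * f2 t + f1 t * df2).
Proof.
move=> [Rf1 If1] [Rf2 If2]; split.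
  under eq_fun do rewrite ReM.
  apply: (is_derive_conv (is_derive_funB (is_derive_funM Rf1 Rf2) (is_derive_funM If1 If2))).
  by rewrite !ReImE; ring.
under eq_fun do rewrite ImM.
apply: (is_derive_conv (is_derive_funD (is_derive_funM Rf1 If2) (is_derive_funM If1 Rf2))).
by rewrite !ReImE; ring.
Qed.

Lemma cderivZ (c : cplx R) f t df : cderiv f t df ->
  cderiv (fun s => c * f s) t (c * df).
Proof.
move=> fd; have := cderivM (cderiv_cst c t) fd.
by rewrite mul0r add0r.
Qed.

Lemma cderiv_sqn f t df : cderiv f t df ->
  is_derive t 1 (fun s => sqn (f s) : R) (2 * (Re (f t) * Re df + Im (f t) * Im df)).
Proof.
move=> [Rf If]; rewrite /sqn.
under eq_fun do rewrite !expr2.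
apply: (is_derive_conv (is_derive_funD (is_derive_funM Rf Rf) (is_derive_funM If If))).
ring.
Qed.

End DerivCalculus.

(** * Monotonicity, boundedness and limits to the right of 0 *)

Lemma nonincr_is_derive (R : realType) (N dN : R -> R) (a b : R) : a <= b ->
  (forall x, a <= x <= b -> is_derive x 1 N (dN x)) ->
  (forall x, a <= x <= b -> dN x <= 0) -> N b <= N a.
Proof.
move=> ab Nd N0; move: ab; rewrite le_eqVlt => /predU1P[->//|ab].
have [||c cab] := @MVT R N dN a b ab.
- by move=> x; rewrite in_itv /= => /andP[ax xb]; apply: Nd; rewrite !ltW.
- apply: derivable_within_continuous => x; rewrite in_itv /= => xab.
  exact: (@ex_derive _ _ _ _ _ _ _ (Nd x xab)).
move: cab; rewrite in_itv /= => /andP[ac cb] E.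
rewrite -subr_le0 E; apply: mulr_le0_ge0; last by rewrite subr_ge0 ltW.
by apply: N0; rewrite !ltW.
Qed.

(* [g' ~ F / t^2] with [F != 0] would make [g] unbounded near [0]. *)
Lemma sq_deriv_lim0 (R : realType) (g g' : R -> R) (rho M F : R) : 0 < rho ->
  (forall t, 0 < t < rho -> is_derive t 1 g (g' t)) ->
  (forall t, 0 < t < rho -> `|g t| <= M) ->
  (fun t => t ^+ 2 * g' t) @ (0 : R)^'+ --> F -> F = 0.
Proof.
move=> rho0 gd gM /cvgrPdist_lt gF; apply/eqP; rewrite -normr_le0.
apply/ler_addgt0Pr => e e0; rewrite add0r.
have e20 : 0 < e / 2 by rewrite divr_gt0.
have [d /= d0 gFd] := gF _ e20.
have M0 : 0 <= M.
  by apply: (le_trans (normr_ge0 (g (rho / 2)))); apply: gM; lra.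
(* The first two bounds keep [[t, 2 t]] inside the domain and inside the range where [t ^+ 2 * g' t]
   is close to [F]. The third gives [(2 t)^2 * (2 M) / t = 8 M t <= e / 2], where [2 M / t] bounds
   the slope of [g] on that interval. *)
pose t := Num.min (Num.min (rho / 4) (d / 4)) (e / (16 * (M + 1))).
have t0 : 0 < t by rewrite !lt_min !divr_gt0 ?mulr_gt0//; lra.
have trho : t <= rho / 4 by rewrite /t !ge_min lexx.
have td : t <= d / 4 by rewrite /t !ge_min lexx orbT.
have te : t <= e / (16 * (M + 1)) by rewrite /t !ge_min lexx !orbT.
have t2t : t < 2 * t by lra.
have [||c] := @MVT R g g' t (2 * t) t2t.
- by move=> x; rewrite in_itv /= => /andP[xt x2t]; apply: gd; lra.
- apply: derivable_within_continuous => x; rewrite in_itv /= => /andP[xt x2t].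
  have xr : 0 < x < rho by lra.
  exact: (@ex_derive _ _ _ _ _ _ _ (gd x xr)).
rewrite in_itv /= => /andP[tc c2t] E.
have c0 : 0 < c by lra.
have := gFd c; rewrite /= sub0r normrN gtr0_norm// => /(_ _ c0) H.
have {}H : `|F - c ^+ 2 * g' c| < e / 2 by apply: H; lra.
have g1 : `|g (2 * t) - g t| <= 2 * M.
  apply: (le_trans (ler_normB _ _)).
  by have := gM t; have := gM (2 * t); lra.
have gc : g' c = (g (2 * t) - g t) / t.
  by rewrite E (_ : 2 * t - t = t); [rewrite mulfK ?gt_eqF|ring].
have h1 : `|c ^+ 2 * g' c| <= e / 2.
  rewrite gc normrM normf_div (gtr0_norm t0) (ger0_norm (sqr_ge0 c)) mulrA ler_pdivrMr//.
  have : c ^+ 2 <= (2 * t) ^+ 2 by rewrite -subr_ge0 subr_sqr mulr_ge0; lra.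
  have : t * (16 * (M + 1)) <= e by rewrite -ler_pdivlMr //; lra.
  move=> h2 h3.
  apply: (@le_trans _ _ ((2 * t) ^+ 2 * (2 * M))).
    by rewrite ler_pM ?sqr_ge0.
  nra.
by have := ler_normD (F - c ^+ 2 * g' c) (c ^+ 2 * g' c); rewrite subrK; lra.
Qed.

(** The differential inequality says that [t ^+ 2 * sqn (f t)] is nonincreasing. It is also
    nonnegative and tends to 0 at [t = 0], because [f] stays bounded there; hence it is 0
    throughout. *)
Lemma blow_up_vanish (R : realType) (f f' : R -> cplx R) (rho d M : R) : 0 < d ->
  (forall t, 0 < t < rho -> cderiv f t (f' t)) ->
  (forall t, 0 < t < d -> sqn (f t) <= M) ->
  (forall t, 0 < t < rho ->
     t ^+ 2 * (Re (f t) * Re (f' t) + Im (f t) * Im (f' t)) <= - t * sqn (f t)) ->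
  forall t, 0 < t < rho -> f t = 0.
Proof.
move=> d0 fd fM fneg t /andP[t0 trho].
have mono s : 0 < s <= t -> t ^+ 2 * sqn (f t) <= s ^+ 2 * sqn (f s).
  move=> /andP[s0 st].
  have hd x : s <= x <= t -> is_derive x 1 (fun y : R => y ^+ 2 * sqn (f y))
      (2 * x * sqn (f x) + x ^+ 2 * (2 * (Re (f x) * Re (f' x) + Im (f x) * Im (f' x)))).
    move=> sxt; apply: is_derive_funM; first exact: is_derive_sqr.
    by apply: cderiv_sqn; apply: fd; lra.
  apply: (nonincr_is_derive st hd) => x sxt.
  by have := fneg x; lra.
have M0 : 0 <= M by apply: (le_trans (sqn_ge0 (f (d / 2)))); apply: fM; lra.
apply: sqn_eq0; apply/eqP; rewrite eq_le sqn_ge0 andbT.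
rewrite -(pmulr_rle0 _ (exprn_gt0 2 t0)).
apply/ler_addgt0Pr => e e0; rewrite add0r.
(* Comparison point near 0: [s <= t] for monotonicity, [s < d] for the bound [M], and the last term
   gives [s ^+ 2 * M <= s * (t * (M + 1)) <= e]. *)
pose s := Num.min (Num.min t (d / 2)) (e / (t * (M + 1))).
have s0 : 0 < s by rewrite !lt_min t0 !divr_gt0// mulr_gt0//; lra.
have st : s <= t by rewrite /s !ge_min lexx.
have sd : s <= d / 2 by rewrite /s !ge_min lexx orbT.
have se : s * (t * (M + 1)) <= e.
  by rewrite -ler_pdivlMr ?mulr_gt0//; [rewrite /s ge_min lexx orbT|lra].
apply: (le_trans (mono s _)); first by rewrite s0.
have : sqn (f s) <= M by apply: fM; lra.
have := sqn_ge0 (f s).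
move: (sqn _) => q q0 qM.
apply: le_trans se; rewrite expr2 -mulrA.
apply: ler_wpM2l; first exact: ltW.
by apply: ler_pM => //; lra.
Qed.

Section RegularContinuity.
Context {K : numFieldType} {T : topologicalType}.
Implicit Types (f g : T -> K^o) (x : T).

Lemma continuousD_at f g x : {for x, continuous f} -> {for x, continuous g} ->
  {for x, continuous (fun t => f t + g t : K^o)}.
Proof. by move=> fc gc; exact: cvgD. Qed.

Lemma continuousN_at f x : {for x, continuous f} ->
  {for x, continuous (fun t => - f t : K^o)}.
Proof. by move=> fc; exact: cvgN. Qed.

Lemma continuousM_at f g x : {for x, continuous f} -> {for x, continuous g} ->
  {for x, continuous (fun t => f t * g t : K^o)}.
Proof. by move=> fc gc; exact: cvgM. Qed.

Lemma continuousC_at (k : K^o) x : {for x, continuous (fun=> k)}.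
Proof. exact: cvg_cst. Qed.

End RegularContinuity.

Lemma near_right_itv (R : realType) (rho : R) : 0 < rho ->
  \forall t \near (0 : R)^'+, 0 < t < rho.
Proof.
move=> rho0; near=> t; apply/andP; split; near: t; first exact: nbhs_right_gt.
exact: nbhs_right_lt.
Unshelve. all: by end_near. Qed.

Lemma cont0_const (R : realType) (f : R -> cplx R) (rho : R) (c : cplx R) : 0 < rho ->
  (forall t, 0 < t < rho -> f t = c) -> {for 0, continuous f} -> f 0 = c.
Proof.
move=> rho0 fc /cvg_at_right_filter f0.
apply: (@norm_cvg_unique _ (cplx R) _ _ _ _ f0).
apply: cvg_near_cst; near=> t; apply: fc; near: t; exact: near_right_itv.
Unshelve. all: by end_near. Qed.

Lemma cderiv0_segment (R : realType) (f : R -> cplx R) (a b : R) : a <= b ->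
  (forall x, a <= x <= b -> cderiv f x 0) -> f a = f b.
Proof.
move=> ab fd.
have fNd x : a <= x <= b -> cderiv (fun y => (-1) * f y) x 0.
  by move=> axb; have := cderivZ (-1) (fd x axb); rewrite mulr0.
have le0 (g : R -> R) : (forall x, a <= x <= b -> is_derive x 1 g 0) -> g b <= g a.
  by move=> hg; apply: (nonincr_is_derive ab hg).
apply: complex_ext; apply/eqP; rewrite eq_le.
  rewrite (le0 (fun y => Re (f y)) (fun x axb => (fd x axb).1)) andbT.
  have := le0 (fun y => Re (-1 * f y)) (fun x axb => (fNd x axb).1).
  by rewrite !mulN1r !ReN lerN2.
rewrite (le0 (fun y => Im (f y)) (fun x axb => (fd x axb).2)) andbT.
have := le0 (fun y => Im (-1 * f y)) (fun x axb => (fNd x axb).2).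
by rewrite !mulN1r !ImN lerN2.
Qed.

Lemma cderiv0_const (R : realType) (f : R -> cplx R) (rho : R) :
  (forall t, 0 < t < rho -> cderiv f t 0) ->
  forall s t, 0 < s < rho -> 0 < t < rho -> f s = f t.
Proof.
move=> fd s t /andP[s0 sr] /andP[t0 tr].
case: (leP s t) => st; first by apply: cderiv0_segment => // x sxt; apply: fd; lra.
by apply/esym/cderiv0_segment; [exact: ltW | move=> x sxt; apply: fd; lra].
Qed.

Lemma continuous0_bounded (R : realType) (f : R -> cplx R) : {for 0, continuous f} ->
  exists rho : R, exists M : R, [/\ 0 < rho,
    forall t, 0 < t < rho -> `|Re (f t)| <= M,
    forall t, 0 < t < rho -> `|Im (f t)| <= M &
    forall t, 0 < t < rho -> sqn (f t) <= M].
Proof.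
move=> fc.
have gR : (fun t => Re (f t) : R) @ (0 : R) --> (Re (f 0) : R).
  exact: (cvg_comp _ _ fc (@Re_continuous R _)).
have gI : (fun t => Im (f t) : R) @ (0 : R) --> (Im (f 0) : R).
  exact: (cvg_comp _ _ fc (@Im_continuous R _)).
have [d1 /= d10 H1] := (@cvgrPdist_lt _ R _ _ _ _ _).1 gR 1 ltr01.
have [d2 /= d20 H2] := (@cvgrPdist_lt _ R _ _ _ _ _).1 gI 1 ltr01.
pose K := `|Re (f 0)| + `|Im (f 0)| + 1.
have K1 : 1 <= K by rewrite /K; have := normr_ge0 (Re (f 0)); have := normr_ge0 (Im (f 0)); lra.
have B t : 0 < t < Num.min d1 d2 -> `|Re (f t)| <= K /\ `|Im (f t)| <= K.
  rewrite lt_min => /andP[t0 /andP[t1 t2]].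
  have {}H1 : `|Re (f 0) - Re (f t)| < 1 by apply: H1; rewrite /= sub0r normrN gtr0_norm.
  have {}H2 : `|Im (f 0) - Im (f t)| < 1 by apply: H2; rewrite /= sub0r normrN gtr0_norm.
  have := normr_ge0 (Re (f 0)); have := normr_ge0 (Im (f 0)).
  have := ler_normB (Re (f 0)) (Re (f 0) - Re (f t)); rewrite opprB addrC subrK.
  have := ler_normB (Im (f 0)) (Im (f 0) - Im (f t)); rewrite opprB addrC subrK.
  by rewrite /K; split; lra.
(* As [K >= 1], the bound [2 * K ^+ 2] of the squared modulus also bounds both components, so one
   constant serves all three estimates. *)
have KK : K <= 2 * K ^+ 2 by nra.
exists (Num.min d1 d2), (2 * K ^+ 2); split.
- by rewrite lt_min d10.
- by move=> t /B[h _]; exact: le_trans KK.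
- by move=> t /B[_ h]; exact: le_trans KK.
- move=> t /B[]; rewrite !ler_norml /sqn => /andP[h1 h2] /andP[h3 h4].
  have : Re (f t) ^+ 2 <= K ^+ 2 by rewrite -subr_ge0 subr_sqr mulr_ge0; lra.
  have : Im (f t) ^+ 2 <= K ^+ 2 by rewrite -subr_ge0 subr_sqr mulr_ge0; lra.
  lra.
Qed.

(** Along [w = i t] the operator [w^2 d/dw] becomes [i t^2 d/dt]. The real and imaginary parts of
    [H] are, up to sign, [t^2] times the derivative of a bounded component of [f], so
    [sq_deriv_lim0] applies. This turns each differential equation into an algebraic relation at
    [w = 0]. *)
Lemma irregular_lim0 (R : realType) (f f' H : R -> cplx R) (rho : R) : 0 < rho ->
  (forall t, 0 < t < rho -> cderiv f t (f' t)) ->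
  (forall t, 0 < t < rho -> 'i%C * (t ^+ 2)%:C * f' t = H t) ->
  {for 0, continuous f} -> {for 0, continuous H} -> H 0 = 0.
Proof.
move=> rho0 fd fH fc Hc.
have [d [M [d0 MR MI _]]] := continuous0_bounded fc.
pose r := Num.min rho d.
have r0 : 0 < r by rewrite lt_min rho0.
have rr t : 0 < t < r -> 0 < t < rho by rewrite lt_min => /andP[-> /andP[-> _]].
have rd t : 0 < t < r -> 0 < t < d by rewrite lt_min => /andP[-> /andP[_ ->]].
have HR : (fun t => Re (H t) : R) @ (0 : R)^'+ --> (Re (H 0) : R).
  by apply: cvg_at_right_filter; exact: (cvg_comp _ _ Hc (@Re_continuous R _)).
have HI : (fun t => Im (H t) : R) @ (0 : R)^'+ --> (Im (H 0) : R).
  by apply: cvg_at_right_filter; exact: (cvg_comp _ _ Hc (@Im_continuous R _)).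
apply: complex_ext => /=.
  apply: (@sq_deriv_lim0 _ (fun t => - Im (f t)) (fun t => - Im (f' t)) r M) => //.
  - by move=> t /rr/fd[_ h]; exact: is_deriveN.
  - by move=> t /rd/MI; rewrite normrN.
  - apply: cvg_trans HR; apply: near_eq_cvg; near=> t.
    rewrite -fH; last by apply: rr; near: t; exact: near_right_itv.
    by rewrite !ReImE /=; ring.
apply: (@sq_deriv_lim0 _ (fun t => Re (f t)) (fun t => Re (f' t)) r M) => //.
- by move=> t /rr/fd[].
- by move=> t /rd/MR.
- apply: cvg_trans HI; apply: near_eq_cvg; near=> t.
  rewrite -fH; last by apply: rr; near: t; exact: near_right_itv.
  by rewrite !ReImE /=; ring.
Unshelve. all: by end_near. Qed.

(** * The irregular differential equation *)

(* The factor [exp (x/w) / w] of a solution is unbounded along [w = i t]. *)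
Lemma upper_right_vanish (R : realType) (x rho : R) (Q Q' : R -> cplx R) : 0 < rho ->
  (forall t, 0 < t < rho -> cderiv Q t (Q' t)) -> {for 0, continuous Q} ->
  (forall t, 0 < t < rho ->
     'i%C * (t ^+ 2)%:C * Q' t = - Q t * (x%:C + 'i%C * t%:C)) ->
  forall t, 0 < t < rho -> Q t = 0.
Proof.
move=> rho0 Qd Qc QE.
have [d [M [d0 _ _ QM]]] := continuous0_bounded Qc.
apply: (blow_up_vanish d0 Qd QM) => t /QE E.
have ER : - (t ^+ 2 * Im (Q' t)) = - (Re (Q t) * x - Im (Q t) * t).
  by have := congr1 (@Re R) E; rewrite !ReImE /= => {}E; lra.
have EI : t ^+ 2 * Re (Q' t) = - (Re (Q t) * t + Im (Q t) * x).
  by have := congr1 (@Im R) E; rewrite !ReImE /= => {}E; lra.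
(* In this inner product the terms with the real number [x] cancel, being a rotation of [Q]; the
   summand [i t] leaves exactly [- t * sqn (Q t)]. *)
have -> : t ^+ 2 * (Re (Q t) * Re (Q' t) + Im (Q t) * Im (Q' t)) =
    Re (Q t) * (t ^+ 2 * Re (Q' t)) + Im (Q t) * - - (t ^+ 2 * Im (Q' t)) by ring.
by rewrite ER EI /sqn; lra.
Qed.

Lemma is_derive0_right (R : realType) (g : R -> R) (l : R) : is_derive (0 : R) 1 g l ->
  (fun t => t^-1 * (g t - g 0)) @ (0 : R)^'+ --> l.
Proof.
move=> gd; have := @ex_derive _ _ _ _ _ _ _ gd; have := @derive_val _ _ _ _ _ _ _ gd.
rewrite /derive /derivable => <- gl.
apply: cvg_trans (cvg_dnbhs_at_right gl).
apply: near_eq_cvg; near=> t.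
by rewrite /= /GRing.scale /= mulr1 addr0.
Unshelve. all: by end_near. Qed.

(* [W = S x - S(0) (x - i t)] solves the homogeneous equation, so [|W / t|] is
   constant; but [W / t] has a limit at [0], which [sq_deriv_lim0] forces to be 0. *)
Lemma lower_left_affine (R : realType) (x rho : R) (S S' : R -> cplx R) (k : cplx R) :
  0 < x -> 0 < rho ->
  (forall t, 0 <= t < rho -> cderiv S t (S' t)) -> {for 0, continuous S} ->
  (forall t, 0 < t < rho ->
     'i%C * (t ^+ 2)%:C * S' t = S t * (x%:C + 'i%C * t%:C) - S 0 * x%:C) ->
  forall t, 0 < t < rho -> S t * x%:C = S 0 * (x%:C - 'i%C * t%:C).
Proof.
move=> x0 rho0 Sd Sc SE.
pose W t := S t * x%:C - S 0 * (x%:C - 'i%C * t%:C).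
pose W' t := S' t * x%:C + 'i%C * S 0.
have idd t : cderiv (fun s : R => s%:C) t (1 : R)%:C.
  by apply: cderiv_real; exact: is_derive_id.
have Wd t : 0 <= t < rho -> cderiv W t (W' t).
  move=> /Sd h.
  have := cderivD (cderivZ x%:C h) (cderivD (cderiv_cst (- S 0 * x%:C) t)
     (cderivZ (S 0 * 'i%C) (idd t))).
  rewrite (_ : (fun s => _) = W); last by apply/funext => s; rewrite /W; ring.
  by rewrite (_ : _ + _ = W' t)//; rewrite /W' rmorph1; ring.
have W0 : W 0 = 0 by rewrite /W mulr0 subr0 subrr.
have WE t : 0 < t < rho -> 'i%C * (t ^+ 2)%:C * W' t = W t * (x%:C + 'i%C * t%:C).
  move=> t0; rewrite /W' mulrDr [_ * (S' t * _)]mulrA SE// /W.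
  have i2 : 'i%C * 'i%C = -1 :> cplx R by rewrite -expr2 sqr_i.
  rewrite rmorphXn /=.
  transitivity ((S t * (x%:C + 'i%C * t%:C) - S 0 * x%:C) * x%:C
    + ('i%C * 'i%C) * t%:C ^+ 2 * S 0); first by ring.
  rewrite i2.
  transitivity (S t * x%:C * (x%:C + 'i%C * t%:C)
    - S 0 * (x%:C ^+ 2 - ('i%C * 'i%C) * t%:C ^+ 2)); first by rewrite i2; ring.
  by ring.
(* Division by [t] absorbs the summand [i t] of the coefficient: [V] solves [i t^2 V' = x V], and
   since [x] is real its modulus is constant. *)
pose V t : cplx R := (t^-1)%:C * W t.
pose V' t := (- t ^- 2)%:C * W t + (t^-1)%:C * W' t.
have Vd t : 0 < t < rho -> cderiv V t (V' t).
  move=> /andP[t0 tr]; apply: cderivM; last by apply: Wd; rewrite ltW.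
  apply: cderiv_real.
  apply: (is_derive_conv (is_deriveV (lt0r_neq0 t0) (is_derive_id t 1))).
  by rewrite /GRing.scale /= mulr1.
have VE t : 0 < t < rho -> 'i%C * (t ^+ 2)%:C * V' t = V t * x%:C.
  move=> t0; rewrite /V' /V.
  have tC0 : t%:C != 0 :> cplx R.
    by case/andP: t0 => t0 _; rewrite eq_complex /= eqxx andbT gt_eqF.
  have E := WE t t0.
  rewrite rmorphN /= fmorphV/= rmorphXn fmorphV /=.
  rewrite rmorphXn /= in E.
  transitivity (t%:C^-1 * ('i%C * t%:C ^+ 2 * W' t) - 'i%C * W t); first by field.
  by rewrite E; field.
have VR t : 0 < t < rho -> t ^+ 2 * Re (V' t) = Im (V t) * x.
  move=> t0; move: (V t) (V' t) (VE t t0) => v v' /(congr1 (@Im R)).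
  by rewrite !ReImE /= => E; lra.
have VI t : 0 < t < rho -> t ^+ 2 * Im (V' t) = - (Re (V t) * x).
  move=> t0; move: (V t) (V' t) (VE t t0) => v v' /(congr1 (@Re R)).
  by rewrite !ReImE /= => E; lra.
have Vc s t : 0 < s < rho -> 0 < t < rho -> sqn (V s) = sqn (V t).
  move=> s0 t0.
  suff : (sqn (V s))%:C = (sqn (V t))%:C by case.
  apply: (@cderiv0_const R (fun u => (sqn (V u))%:C) rho) => // u u0.
  have := cderiv_real (cderiv_sqn (Vd u u0)).
  rewrite (_ : 2 * _ = 0)//.
  case/andP: (u0) => u1 _; apply: (mulfI (expf_neq0 2 (lt0r_neq0 u1))).
  transitivity (2 * (Re (V u) * (u ^+ 2 * Re (V' u)) + Im (V u) * (u ^+ 2 * Im (V' u)))).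
    by ring.
  by rewrite VR// VI//; ring.
have half0 : 0 < rho / 2 < rho by lra.
pose N := sqn (V (rho / 2)).
have VN t : 0 < t < rho -> sqn (V t) = N by move=> t0; exact: Vc.
have N0 : 0 <= N by exact: sqn_ge0.
have VRb t : 0 < t < rho -> `|Re (V t)| <= N + 1.
  by move=> /VN; rewrite /sqn ler_norml => E; apply/andP; split; nra.
have VIb t : 0 < t < rho -> `|Im (V t)| <= N + 1.
  by move=> /VN; rewrite /sqn ler_norml => E; apply/andP; split; nra.
have [WR0 WI0] := Wd 0 (introT andP (conj (lexx _) rho0)).
(* Since [W 0 = 0], the quotient [V = W / t] converges to the derivative [W' 0]; this is where
   differentiability at [t = 0] itself enters. *)
have RVl : (fun t => Re (V t)) @ (0 : R)^'+ --> Re (W' 0).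
  apply: cvg_trans (is_derive0_right WR0); apply: near_eq_cvg; near=> t.
  by rewrite W0 /V ReM /= mul0r !subr0.
have IVl : (fun t => Im (V t)) @ (0 : R)^'+ --> Im (W' 0).
  apply: cvg_trans (is_derive0_right WI0); apply: near_eq_cvg; near=> t.
  by rewrite W0 /V ImM /= mul0r addr0 subr0.
have mulx (g : R -> R) (l : R) : g @ (0 : R)^'+ --> l ->
    (fun t => g t * x) @ (0 : R)^'+ --> l * x.
  by move=> gl; apply: cvgM gl _; exact: cvg_cst.
(* Here [t^2 Re V' = x Im V] has the limit [x Im (W' 0)], while [Re V] is bounded, so the limit must
   be 0. *)
have IL : Im (W' 0) * x = 0.
  apply: (@sq_deriv_lim0 _ (fun t => Re (V t)) (fun t => Re (V' t)) rho (N + 1)) => //.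
    by move=> t /Vd[].
  apply: cvg_trans (mulx _ _ IVl).
  apply: near_eq_cvg; near=> t; rewrite VR//; near: t; exact: near_right_itv.
have RL : Re (W' 0) * x = 0.
  apply/eqP; rewrite -oppr_eq0; apply/eqP.
  apply: (@sq_deriv_lim0 _ (fun t => Im (V t)) (fun t => Im (V' t)) rho (N + 1)) => //.
    by move=> t /Vd[].
  apply: cvg_trans (cvgN (mulx _ _ RVl)).
  apply: near_eq_cvg; near=> t; rewrite VI//; near: t; exact: near_right_itv.
have NL : (fun t => sqn (V t)) @ (0 : R)^'+ --> sqn (W' 0).
  apply: cvgD; rewrite expr2; under eq_fun do rewrite expr2; exact: cvgM.
have N00 : N = 0.
  have -> : N = sqn (W' 0).
    apply: (norm_cvg_unique _ NL).
    apply: cvg_near_cst; near=> t; apply: VN; near: t; exact: near_right_itv.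
  move/eqP: IL; move/eqP: RL; rewrite !mulf_eq0 (gt_eqF x0) !orbF /sqn.
  by move=> /eqP-> /eqP->; rewrite expr0n addr0.
move=> t t0; have /sqn_eq0/eqP := etrans (VN t t0) N00.
rewrite /V mulf_eq0 => /orP[|].
  by case/andP: t0 => t0 _; rewrite eq_complex /= eqxx andbT invr_eq0 gt_eqF.
by rewrite subr_eq0 => /eqP.
Unshelve. all: by end_near. Qed.

(* For [G = [[P, Q], [T, S]]] the four equations say
   [w^2 dG/dw = G (A2 + w B0) - (A1 + w B0) G] along [w = i t], with
   [A1 = [[x, 0], [c x^2, 0]]] and [A2 = [[a, 0], [b, d]]].  On this ray both
   [exp (x/w)] and [exp (- x/w)] have modulus 1, so one ray serves all entries. *)
Lemma gauge_core (R : realType) (x rho : R) (c a b d : cplx R)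
    (P Q T S P' Q' T' S' : R -> cplx R) : 0 < x -> 0 < rho ->
  (forall t, 0 <= t < rho -> cderiv P t (P' t)) -> {for 0, continuous P} ->
  (forall t, 0 <= t < rho -> cderiv Q t (Q' t)) -> {for 0, continuous Q} ->
  (forall t, 0 <= t < rho -> cderiv T t (T' t)) -> {for 0, continuous T} ->
  (forall t, 0 <= t < rho -> cderiv S t (S' t)) -> {for 0, continuous S} ->
  (forall t, 0 < t < rho ->
     'i%C * (t ^+ 2)%:C * P' t = P t * (a - x%:C) + Q t * b) ->
  (forall t, 0 < t < rho ->
     'i%C * (t ^+ 2)%:C * Q' t = Q t * (d - x%:C - 'i%C * t%:C)) ->
  (forall t, 0 < t < rho ->
     'i%C * (t ^+ 2)%:C * T' t =
     T t * (a + 'i%C * t%:C) + S t * b - c * x%:C ^+ 2 * P t) ->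
  (forall t, 0 < t < rho ->
     'i%C * (t ^+ 2)%:C * S' t = S t * d - c * x%:C ^+ 2 * Q t) ->
  P 0 * S 0 - Q 0 * T 0 != 0 ->
  [/\ a = x%:C, d = 0, S 0 * b = c * x%:C ^+ 2 * P 0 - x%:C * T 0 &
      forall t, 0 < t < rho -> T t * x%:C = T 0 * (x%:C - 'i%C * t%:C)].
Proof.
move=> x0 rho0 Pd Pc Qd Qc Td Tc Sd Sc PE QE TE SE det0.
have ltd (f f' : R -> cplx R) : (forall t, 0 <= t < rho -> cderiv f t (f' t)) ->
    forall t, 0 < t < rho -> cderiv f t (f' t).
  by move=> fd t /andP[t0 tr]; apply: fd; rewrite ltW.
have xC0 : x%:C != 0 :> cplx R by apply: contraTneq x0 => -[->]; rewrite ltxx.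
have itc : {for 0, continuous (fun t : R => 'i%C * t%:C : cplx R)}.
  apply: (@continuousM_at R[i] R _ _ 0); first exact: (@continuousC_at R[i] R).
  exact: real_complex_continuous.
have Mc (f g : R -> cplx R) : {for 0, continuous f} -> {for 0, continuous g} ->
  {for 0, continuous (fun t => f t * g t)} by exact: (@continuousM_at R[i] R f g 0).
have Dc (f g : R -> cplx R) : {for 0, continuous f} -> {for 0, continuous g} ->
  {for 0, continuous (fun t => f t + g t)} by exact: (@continuousD_at R[i] R f g 0).
have Nc (f : R -> cplx R) : {for 0, continuous f} ->
  {for 0, continuous (fun t => - f t)} by exact: (@continuousN_at R[i] R f 0).
have Cc (k : cplx R) : {for 0, continuous (fun t : R => k)} by exact: (@continuousC_at R[i] R k 0).
(* The four equations are first evaluated at [w = 0], where the left-hand sides tend to 0. *)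
have P0 : P 0 * (a - x%:C) + Q 0 * b = 0.
  apply: (irregular_lim0 rho0 (ltd _ _ Pd) PE Pc).
  exact (Dc _ _ (Mc _ _ Pc (Cc _)) (Mc _ _ Qc (Cc _))).
have Q0 : Q 0 * (d - x%:C - 'i%C * 0%:C) = 0.
  apply: (irregular_lim0 rho0 (ltd _ _ Qd) QE Qc).
  exact (Mc _ _ Qc (Dc _ _ (Cc _) (Nc _ itc))).
have T0 : T 0 * (a + 'i%C * 0%:C) + S 0 * b - c * x%:C ^+ 2 * P 0 = 0.
  apply: (irregular_lim0 rho0 (ltd _ _ Td) TE Tc).
  exact (Dc _ _ (Dc _ _ (Mc _ _ Tc (Dc _ _ (Cc _) itc)) (Mc _ _ Sc (Cc _)))
    (Nc _ (Mc _ _ (Cc _) Pc))).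
have S0 : S 0 * d - c * x%:C ^+ 2 * Q 0 = 0.
  apply: (irregular_lim0 rho0 (ltd _ _ Sd) SE Sc).
  exact (Dc _ _ (Mc _ _ Sc (Cc _)) (Nc _ (Mc _ _ (Cc _) Qc))).
move: Q0 T0; rewrite mulr0 subr0 addr0 => Q0 T0.
(* The other case is [d = x]. There the equation of [Q] is that of [upper_right_vanish] with
   [x = 0], so [Q] vanishes for [t > 0] and, by continuity, at 0. *)
have {}Q0 : Q 0 = 0.
  move/eqP: Q0; rewrite mulf_eq0 => /orP[/eqP//|/eqP dx].
  apply: (cont0_const rho0 _ Qc).
  apply: (upper_right_vanish (x := 0) rho0 (ltd _ _ Qd) Qc) => t t0.
  by rewrite QE// dx; ring.
have PS0 : P 0 * S 0 != 0 by move: det0; rewrite Q0 mul0r subr0.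
have [P00 S00] : P 0 != 0 /\ S 0 != 0 by move: PS0; rewrite mulf_eq0 negb_or => /andP.
have ax : a = x%:C.
  move/eqP: P0; rewrite Q0 mul0r addr0 mulf_eq0 (negPf P00) /= subr_eq0.
  by move/eqP.
have d0 : d = 0.
  by move/eqP: S0; rewrite Q0 mulr0 subr0 mulf_eq0 (negPf S00) /= => /eqP.
have Qv : forall t, 0 < t < rho -> Q t = 0.
  apply: (upper_right_vanish (x := x) rho0 (ltd _ _ Qd) Qc) => t t0.
  by rewrite QE// d0; ring.
have it0 t : 0 < t < rho -> 'i%C * (t ^+ 2)%:C != 0 :> cplx R.
  move=> /andP[t0 _]; rewrite mulf_neq0//.
    by rewrite eq_complex /= oner_eq0 andbF.
  by rewrite eq_complex /= eqxx andbT expf_neq0// gt_eqF.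
have Pconst t : 0 < t < rho -> P t = P 0.
  move=> t0; apply/esym/(cont0_const rho0 _ Pc) => s s0.
  apply: (cderiv0_const _ s0 t0) => u u0.
  rewrite (_ : 0 = P' u); first exact: (ltd _ _ Pd).
  apply: (mulfI (it0 u u0)); rewrite mulr0 PE// ax subrr mulr0 Qv// mul0r addr0//.
have Sconst t : 0 < t < rho -> S t = S 0.
  move=> t0; apply/esym/(cont0_const rho0 _ Sc) => s s0.
  apply: (cderiv0_const _ s0 t0) => u u0.
  rewrite (_ : 0 = S' u); first exact: (ltd _ _ Sd).
  apply: (mulfI (it0 u u0)); rewrite mulr0 SE// d0 mulr0 Qv// mulr0 subr0//.
have Sb : S 0 * b = c * x%:C ^+ 2 * P 0 - x%:C * T 0.
  by move: T0; rewrite ax => /eqP; rewrite subr_eq0 => /eqP <-; ring.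
split => //.
(* With [P] and [S] constant, the inhomogeneous term [S b - c x^2 P] equals [- x T 0] by [Sb]. *)
apply: (lower_left_affine (S' := T')) => // t t0.
rewrite TE// Pconst// Sconst// ax Sb; ring.
Qed.

(** * Rules for explicit differentials *)

Section DiffCalculus.
Context {K : numFieldType} {V : normedModType K}.
Implicit Types (f g df dg : V -> K^o) (p : V).

Lemma is_diff_linear_fun (W : normedModType K) (f : V -> W) : linear f -> continuous f ->
  forall p, is_diff p f f.
Proof.
move=> flin fcont p.
pose fM := GRing.isLinear.Build _ _ _ _ _ flin.
pose fL : {linear _ -> _} := HB.pack f fM.
have -> : f = fL by [].
by apply: DiffDef; [exact: linear_differentiable | exact: diff_lin].
Qed.

Lemma is_diff_funC (W : normedModType K) (c : W) p : is_diff p (fun=> c) (fun=> 0).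
Proof. exact: is_diff_cst. Qed.

Lemma is_diff_funD (W : normedModType K) (f g df dg : V -> W) p :
  is_diff p f df -> is_diff p g dg ->
  is_diff p (fun q => f q + g q) (fun u => df u + dg u).
Proof. by move=> fd gd; exact: is_diffD. Qed.

Lemma is_diff_funM f g df dg p : is_diff p f df -> is_diff p g dg ->
  is_diff p (fun q => f q * g q : K^o) (fun u => df u * g p + f p * dg u : K^o).
Proof.
move=> fd gd; have H := is_diffM fd gd.
have -> : (fun u => df u * g p + f p * dg u : K^o) = f p *: dg + g p *: df.
  by apply/funext => u; rewrite addrC (mulrC (df u)).
exact: H.
Qed.

Lemma is_diff_funZ (W : normedModType K) f df p (M : W) : is_diff p f df ->
  is_diff p (fun q => f q *: M) (fun u => df u *: M).
Proof.
move=> fd; apply: DiffDef; first exact: differentiableZl.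
have -> : (fun u => df u *: M) = (fun u => 'd f p u *: M) by rewrite diff_val.
exact: diffZl.
Qed.

Lemma is_diff_funV f df p : f p != 0 -> is_diff p f df ->
  is_diff p (fun q => (f q)^-1 : K^o) (fun u => - (f p) ^- 2 * df u : K^o).
Proof.
move=> fp0 fd; have fdp : differentiable f p by exact: (@ex_diff _ _ _ _ _ _ _ fd).
apply: DiffDef; first exact: differentiableV.
by rewrite diffV// diff_val.
Qed.

Lemma is_diff_conv (W : normedModType K) (f df df' : V -> W) p :
  is_diff p f df -> df =1 df' -> is_diff p f df'.
Proof. by move=> fd /funext <-. Qed.

End DiffCalculus.

Section LowerTriangular.
Context {K : fieldType}.
Implicit Types a b k : K^o.

(** The matrices [a *: E00 + b *: E10] have zero second column and are closed under products. The
    model's [A], [C] and polar part all have this shape, which reduces matrix identities to pairs of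
    scalar ones. *)
Definition E00 : 'M[K^o]_2 := delta_mx 0 0.
Definition E10 : 'M[K^o]_2 := delta_mx 1 0.

Lemma mulmx_E a b a' b' : (a *: E00 + b *: E10) *m (a' *: E00 + b' *: E10) =
  (a * a') *: E00 + (b * a') *: E10.
Proof.
rewrite mulmxDl !mulmxDr -!scalemxAl -!scalemxAr !mul_delta_mx_cond /=.
by rewrite !mulr0n !scaler0 !addr0 !mulr1n !scalerA.
Qed.

Lemma scale_E k a b : k *: (a *: E00 + b *: E10) = (k * a) *: E00 + (k * b) *: E10.
Proof. by rewrite scalerDr !scalerA. Qed.

Lemma add_E a b a' b' : (a *: E00 + b *: E10) + (a' *: E00 + b' *: E10) =
  (a + a') *: E00 + (b + b') *: E10.
Proof. by rewrite addrACA -!scalerDl. Qed.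

Lemma opp_E a b : - (a *: E00 + b *: E10) = (- a) *: E00 + (- b) *: E10.
Proof. by rewrite opprD !scaleNr. Qed.

End LowerTriangular.

Section ModelMatrices.
Context {R : realType}.
Implicit Types (c : cplx R) (x y : cspace R 1) (p q : wspace R 1).

Lemma is_diff_w p : is_diff p (fun q : wspace R 1 => q.1 : cplx R) (fun u => u.1).
Proof.
apply: (@is_diff_linear_fun R[i] (wspace R 1) (cplx R)) => //.
by move=> q; exact: cvg_fst.
Qed.

Lemma is_diff_coord x : is_diff x (fun y : cspace R 1 => y 0 0 : cplx R) (fun u => u 0 0).
Proof.
apply: (@is_diff_linear_fun R[i] (cspace R 1) (cplx R)).
  by move=> k y z; rewrite !mxE.
exact: (@coord_continuous R[i] 1 1 0 0).
Qed.

Lemma is_diff_x p : is_diff p (fun q : wspace R 1 => q.2 0 0 : cplx R) (fun u => u.2 0 0).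
Proof.
apply: (@is_diff_linear_fun R[i] (wspace R 1) (cplx R)).
  by move=> k y z; rewrite !mxE.
move=> q; apply: (@continuous_comp _ _ _ (fun q : wspace R 1 => q.2) (fun y : cspace R 1 => y 0 0 : cplx R)).
  exact: cvg_snd.
exact: (@coord_continuous R[i] 1 1 0 0).
Qed.

End ModelMatrices.

(** * The model deformations *)

Section ModelScalars.
Context {K : fieldType}.

(** This is [w^2] times the normal form [-(A + B_o/z) dz - z C] of the model at [(w, x)], evaluated
    on the tangent vector [(v1, v2)]. Being polynomial, it is holomorphic across [w = 0]. *)
Definition polar_mx (c w x v1 v2 : K^o) : 'M[K^o]_2 :=
  (v1 * (x + w) - w * v2) *: E00 + (c * (v1 * x ^+ 2 - w * x * v2)) *: E10.

Lemma normal_matrix_scalars (c w x v1 v2 : K^o) :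
  - (- (w ^- 2 * v1) *: (x *: E00 + (c * x ^+ 2) *: E10 + w *: E00)) -
    w^-1 *: (v2 *: E00 + (c * x * v2) *: E10) = w ^- 2 *: polar_mx c w x v1 v2.
Proof.
have -> : w *: E00 = w *: E00 + 0 *: E10 :> 'M[K^o]_2 by rewrite scale0r addr0.
rewrite /polar_mx add_E scale_E opp_E scale_E opp_E add_E scale_E.
(* At [w = 0] both sides vanish by the convention [0^-1 = 0]. *)
have [->|w0] := eqVneq w 0; last by congr (_ *: _ + _ *: _); field.
by congr (_ *: _ + _ *: _); rewrite !expr0n !invr0; ring.
Qed.

Lemma polar_mx_linear (c w x k v1 v2 u1 u2 : K^o) :
  polar_mx c w x (k * v1 + u1) (k * v2 + u2) =
  k *: polar_mx c w x v1 v2 + polar_mx c w x u1 u2.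
Proof. by rewrite /polar_mx scale_E add_E; congr (_ *: _ + _ *: _); ring. Qed.

(** The derivative of [w ^- 2 *: polar_mx c w x v1 v2] at [(w, x)] in the direction [(a, b)]. *)
Definition dpole_mx (c w x v1 v2 a b : K^o) : 'M[K^o]_2 :=
  (- 2 * w^-1 ^+ 3 * a * v1 * x + w^-1 ^+ 2 * v1 * b
     - w^-1 ^+ 2 * a * (v1 - v2)) *: E00 +
  (c * (- 2 * w^-1 ^+ 3 * a * v1 * x ^+ 2 + 2 * w^-1 ^+ 2 * v1 * x * b
     + w^-1 ^+ 2 * a * x * v2 - w^-1 * b * v2)) *: E10.

Lemma flat_scalars (c w x v1 v2 a b : K^o) : w != 0 ->
  let V := w ^- 2 *: polar_mx c w x v1 v2 in
  let U := w ^- 2 *: polar_mx c w x a b in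
  dpole_mx c w x v1 v2 a b - dpole_mx c w x a b v1 v2 + (U *m V - V *m U) = 0.
Proof.
move=> w0 /=; rewrite /polar_mx /dpole_mx.
rewrite !scale_E !mulmx_E !opp_E !add_E.
rewrite [X in X *: _ + _](_ : _ = 0); last by field.
rewrite [X in _ + X *: _](_ : _ = 0); last by field.
by rewrite !scale0r addr0.
Qed.

End ModelScalars.

Section ModelDiff.
Context {K : numFieldType} {V : normedModType K}.

Lemma is_diff_polar_mx (c v1 v2 : K^o) (W X dW dX : V -> K^o) p :
  is_diff p W dW -> is_diff p X dX ->
  is_diff p (fun q => polar_mx c (W q) (X q) v1 v2)
  (fun u => (v1 * (dX u + dW u) - dW u * v2) *: E00 +
    (c * (2 * v1 * X p * dX u - (dW u * X p + W p * dX u) * v2)) *: E10).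
Proof.
move=> HW HX.
have Cst (k : K^o) := @is_diff_funC K V K^o k p.
have D1 := is_diff_funD (is_diff_funM (Cst v1) (is_diff_funD HX HW))
  (is_diff_funM (is_diff_funM (Cst (-1)) HW) (Cst v2)).
have D2 := is_diff_funM (Cst c) (is_diff_funD (is_diff_funM (Cst v1) (is_diff_funM HX HX))
  (is_diff_funM (Cst (-1)) (is_diff_funM (is_diff_funM HW HX) (Cst v2)))).
have D := is_diff_funD (is_diff_funZ (E00 : 'M[K^o]_2) D1) (is_diff_funZ (E10 : 'M[K^o]_2) D2).
rewrite (_ : (fun q => polar_mx _ _ _ _ _) = (fun q =>
  (v1 * (X q + W q) + -1 * W q * v2) *: (E00 : 'M[K^o]_2) +
  (c * (v1 * (X q * X q) + -1 * (W q * X q * v2))) *: (E10 : 'M[K^o]_2))); last first.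
  by apply/funext => q; rewrite /polar_mx; congr (_ *: _ + _ *: _); ring.
apply: (is_diff_conv D) => u /=.
by congr (_ *: _ + _ *: _); ring.
Qed.

Lemma is_diff_pole_mx (c v1 v2 : K^o) (W X dW dX : V -> K^o) p :
  W p != 0 -> is_diff p W dW -> is_diff p X dX ->
  is_diff p (fun q => W q ^- 2 *: polar_mx c (W q) (X q) v1 v2)
  (fun u => dpole_mx c (W p) (X p) v1 v2 (dW u) (dX u)).
Proof.
move=> p0 HW HX.
have HV := is_diff_funV p0 HW.
have Cst (k : K^o) := @is_diff_funC K V K^o k p.
have V2 := is_diff_funM HV HV.
have D1 := is_diff_funM V2 (is_diff_funD (is_diff_funM (Cst v1) (is_diff_funD HX HW))
  (is_diff_funM (is_diff_funM (Cst (-1)) HW) (Cst v2))).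
have D2 := is_diff_funM V2 (is_diff_funM (Cst c) (is_diff_funD (is_diff_funM (Cst v1) (is_diff_funM HX HX))
  (is_diff_funM (Cst (-1)) (is_diff_funM (is_diff_funM HW HX) (Cst v2))))).
have D := is_diff_funD (is_diff_funZ (E00 : 'M[K^o]_2) D1) (is_diff_funZ (E10 : 'M[K^o]_2) D2).
rewrite (_ : (fun q => _ *: polar_mx _ _ _ _ _) = (fun q =>
  ((W q)^-1 * (W q)^-1 * (v1 * (X q + W q) + -1 * W q * v2)) *: (E00 : 'M[K^o]_2) +
  ((W q)^-1 * (W q)^-1 * (c * (v1 * (X q * X q) + -1 * (W q * X q * v2)))) *: (E10 : 'M[K^o]_2))); last first.
  apply/funext => q; rewrite /polar_mx scale_E -exprVn.
  by congr (_ *: _ + _ *: _); ring.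
apply: (is_diff_conv D) => u /=; rewrite /dpole_mx.
by congr (_ *: _ + _ *: _); field.
Qed.

End ModelDiff.

Section Model.
Context {R : realType}.
Implicit Types (c : cplx R) (x y : cspace R 1) (p q : wspace R 1).

Definition B0 : cmx R 2 := E00.

Definition modelA c x : cmx R 2 := x 0 0 *: E00 + (c * x 0 0 ^+ 2) *: E10.
(** Forced by [dA = C + [C, B_o]]: the commutator doubles the lower left entry of [C], so the
    derivative [2 c x] of [c x^2] leaves [c x]. *)
Definition modelC c x (v : cspace R 1) : cmx R 2 :=
  v 0 0 *: E00 + (c * x 0 0 * v 0 0) *: E10.

Definition model_polar c p (v : wspace R 1) : cmx R 2 :=
  polar_mx c p.1 (p.2 0 0) v.1 (v.2 0 0).

Lemma normal_matrix_model c p v :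
  normal_matrix B0 (modelA c) (modelC c) p v = pole2 (model_polar c) p v.
Proof. exact (@normal_matrix_scalars R[i] c p.1 (p.2 0 0) v.1 (v.2 0 0)). Qed.

Lemma is_diff_pole2_model c p v : p.1 != 0 -> is_diff p (fun q => pole2 (model_polar c) q v)
  (fun u => dpole_mx c p.1 (p.2 0 0) v.1 (v.2 0 0) u.1 (u.2 0 0)).
Proof.
move=> p0.
exact (@is_diff_pole_mx R[i] _ c v.1 (v.2 0 0) _ _ _ _ p p0 (is_diff_w p) (is_diff_x p)).
Qed.

Lemma model_flat c p u v : p.1 != 0 ->
  dform (pole2 (model_polar c)) p u v + wedge (pole2 (model_polar c)) p u v = 0.
Proof.
move=> p0; rewrite /dform /wedge.
have Dv := congr1 (@^~ u) (@diff_val _ _ _ _ _ _ _ (is_diff_pole2_model c v p0)).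
have Du := congr1 (@^~ v) (@diff_val _ _ _ _ _ _ _ (is_diff_pole2_model c u p0)).
refine (etrans (congr2 (fun A B : cmx R 2 => A - B + _) Dv Du) _).
exact (@flat_scalars R[i] c p.1 (p.2 0 0) v.1 (v.2 0 0) u.1 (u.2 0 0) p0).
Qed.

End Model.

Lemma affine_continuous (K : numFieldType) (V : normedModType K) (T : topologicalType)
    (f : T -> K) (p v : V) (x : T) : f @ x --> f x ->
  {for x, continuous (fun t => p + f t *: v)}.
Proof.
move=> fc; have h1 : (fun _ : T => p) @ x --> p by exact: cvg_cst.
have h2 : (fun t => f t *: v) @ x --> f x *: v by apply: cvgZr_tmp.
exact: cvgD h1 h2.
Qed.

Lemma line_continuous (R : realType) (V : normedModType R[i]) (p v : V) :
  continuous (fun t : R => p + t%:C *: v).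
Proof.
move=> t; apply: (@affine_continuous R[i] V R (fun t => t%:C)).
exact: real_complex_continuous.
Qed.

(** The space is the union of the real lines through 0, each the continuous image of the real
    line. *)
Lemma connected_normedT (R : realType) (V : normedModType R[i]) : connected [set: V].
Proof.
have -> : [set: V] = \bigcup_(v in [set: V]) ((fun t : R => (0 : V) + t%:C *: v) @` [set: R]).
  apply/seteqP; split => // v _; exists v => //.
  by exists (1 : R) => //; rewrite add0r rmorph1 scale1r.
apply: bigcup_connected.
  by exists 0 => v _; exists (0 : R) => //; rewrite add0r rmorph0 scale0r.
move=> v _; apply: connected_continuous_connected.
  by apply/connected_intervalP; move=> ? ? ? ?.
by apply: continuous_subspaceT; exact: line_continuous.
Qed.

Lemma open_norm_lt (K : numFieldType) (V : normedModType K) (r : K) :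
  open [set w : V | `|w| < r].
Proof.
rewrite openE => w /= wr; rewrite /interior.
have d0 : 0 < r - `|w| by rewrite subr_gt0.
apply: filterS (near_dist w d0) => y /= h.
have := ler_normD w (y - w); rewrite addrC subrK => /le_lt_trans; apply.
by rewrite -ltrBrDl distrC.
Qed.

Section LowerUnipotent.
Context {K : fieldType}.
Implicit Types k a b : K^o.

Definition low k : 'M[K^o]_2 := 1%:M + k *: E10.

Lemma mul_E10E10 : E10 *m E10 = 0 :> 'M[K^o]_2.
Proof. by rewrite mul_delta_mx_cond. Qed.

Lemma mul_E00E10 : E00 *m E10 = 0 :> 'M[K^o]_2.
Proof. by rewrite mul_delta_mx_cond. Qed.

Lemma mul_E10E00 : E10 *m E00 = E10 :> 'M[K^o]_2.
Proof. by rewrite mul_delta_mx. Qed.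

Lemma low_mulV k : low (- k) *m low k = 1%:M.
Proof.
rewrite /low mulmxDl !mulmxDr !mul1mx mulmx1 -scalemxAl -scalemxAr mul_E10E10.
by rewrite !scaler0 addr0 -addrA -scalerDl subrr scale0r addr0.
Qed.

Lemma low_unit k : low k \in unitmx.
Proof. by case/mulmx1_unit: (low_mulV k). Qed.

Lemma invmx_low k : invmx (low k) = low (- k).
Proof.
by rewrite -[LHS]mul1mx -(low_mulV k) -mulmxA mulmxV ?low_unit// mulmx1.
Qed.

(** With [k = c x], one and the same matrix diagonalizes [A] (for [a = x]) and [C] (for [a = v]),
    both being multiples of [E00 + (c x) E10]. *)
Lemma low_conj k a : invmx (low k) *m (a *: E00 + (k * a) *: E10) *m low k = a *: E00.
Proof.
rewrite invmx_low -mulmxA.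
have -> : (a *: E00 + (k * a) *: E10) *m low k = a *: E00 + (k * a) *: E10.
  rewrite /low mulmxDr mulmx1 -scalemxAr mulmxDl -!scalemxAl mul_E00E10 mul_E10E10.
  by rewrite !scaler0 addr0 scaler0 addr0.
rewrite /low mulmxDl mul1mx -scalemxAl mulmxDr -!scalemxAr mul_E10E00 mul_E10E10.
by rewrite scaler0 addr0 scalerA mulNr scaleNr addrK.
Qed.

Lemma scale_E00_diag a : a *: E00 = diag_mx (\row_i (if i == 0 then a else 0)) :> 'M[K^o]_2.
Proof.
apply/matrixP => i j; rewrite !mxE.
by case: (unliftP ord0 i) => [i'|] ->; case: (unliftP ord0 j) => [j'|] -> /=;
  rewrite ?mulr0 ?mulr1 ?mulr0n ?mul0rn ?mulr1n//.
Qed.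

End LowerUnipotent.

Lemma gauge1 (R : realType) (V : normedModType R[i]) (n : nat)
    (omega : V -> V -> cmx R n) (p v : V) :
  gauge (fun=> 1%:M) omega p v = omega p v.
Proof.
rewrite /gauge (_ : 'd _ p v = 0); last by rewrite diff_cst.
by rewrite mulmx0 addr0 invmx1 mul1mx mulmx1.
Qed.

Lemma holo_unit1 (R : realType) (V : normedModType R[i]) (n : nat) (U : set V) :
  holo_unit U (fun=> 1%:M : cmx R n).
Proof. by split => [p _|p _]; [exact: differentiable_cst | exact: unitmx1]. Qed.

Section ModelDeformation.
Context {R : realType}.
Variable c : cplx R.

Let S : set (wspace R 1) := disc 1 `*` [set: cspace R 1].

Lemma model_dom_open (i : unit) : open S.
Proof.
rewrite (_ : S = (fun q : wspace R 1 => q.1) @^-1` (disc 1 : set (cplx R))); last first.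
  by apply/seteqP; split => [q []|q] //= ?; split.
apply: (@open_comp (wspace R 1) (cplx R)); first by move=> q _; exact: cvg_fst.
exact: (@open_norm_lt R[i] (cplx R)).
Qed.

Lemma model_cover p : S p <-> exists i : unit, S p.
Proof. by split => [h|[]//]; exists tt. Qed.

Lemma model_cocycle (i j k : unit) (p : wspace R 1) : S p -> S p -> S p ->
  1%:M *m 1%:M = 1%:M :> cmx R 2.
Proof. by move=> _ _ _; exact: mul1mx. Qed.

Lemma model_polar_holo (i : unit) : holo_form S (model_polar c).
Proof.
split.
  move=> p _ a u v; rewrite /model_polar /= !mxE.
  exact (@polar_mx_linear R[i] c p.1 (p.2 0 0) a u.1 (u.2 0 0) v.1 (v.2 0 0)).
move=> v p _.
exact: (@ex_diff _ _ _ _ _ _ _ (@is_diff_polar_mx R[i] _ c v.1 (v.2 0 0) _ _ _ _ p (is_diff_w p) (is_diff_x p))).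
Qed.

Lemma model_compat (i j : unit) p (v : wspace R 1) : S p -> S p -> p.1 != 0 ->
  pole2 (model_polar c) p v = gauge (fun=> 1%:M) (pole2 (model_polar c)) p v.
Proof. by move=> _ _ _; rewrite gauge1. Qed.

(** A single global frame over the unit disc times the whole line, hence identity transition
    matrices. *)
Definition model_bundle : conn_bundle 2 S :=
  @ConnBundle R 2 1 S unit (fun=> S) (fun _ _ _ => 1%:M) (fun=> model_polar c)
    model_dom_open model_cover
    (fun i j => @holo_unit1 R (wspace R 1) 2 _)
    model_cocycle model_polar_holo model_compat
    (fun i p u v _ p0 => model_flat c u v p0).

Lemma model_restr : slice_basis_with_matrix (E := model_bundle) (0 : cspace R 1)
  (fun _ _ => 1%:M) (Omega_o 0 B0).
Proof.
split.
- by move=> i; exact: (@holo_unit1 R (cplx R) 2).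
- by move=> i j w _ _ /=; rewrite mul1mx.
- move=> i w u _ w0; rewrite (gauge1 (V := cplx R)) /cb_conn /= -normal_matrix_model.
  rewrite /normal_matrix /Omega_o /modelA /modelC /= !mxE.
  by rewrite expr0n !mulr0 !scale0r !addr0 scaler0 subr0.
Qed.

Definition model_def : int_deformation 0 (B0 : cmx R 2) :=
  @IntDeformation R 2 0 B0 1 [set: cspace R 1] 0 1 model_bundle (fun _ _ => 1%:M)
    openT (@connected_normedT R _) I ltr01 model_restr.

End ModelDeformation.

Section ModelAlgebra.
Context {K : fieldType}.

Lemma model_wedge_scalars (k u v : K^o) :
  (u *: E00 + (k * u) *: E10) *m (v *: E00 + (k * v) *: E10) -
  (v *: E00 + (k * v) *: E10) *m (u *: E00 + (k * u) *: E10) = 0 :> 'M[K^o]_2.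
Proof.
rewrite !mulmx_E opp_E add_E.
rewrite [X in X *: _ + _](_ : _ = 0); last by ring.
rewrite [X in _ + X *: _](_ : _ = 0); last by ring.
by rewrite !scale0r addr0.
Qed.

Lemma model_deriv_scalars (c x v : K^o) :
  v *: E00 + (c * (2 * x * v)) *: E10 =
  v *: E00 + (c * x * v) *: E10 + ((v *: E00 + (c * x * v) *: E10) *m E00 -
   E00 *m (v *: E00 + (c * x * v) *: E10)) :> 'M[K^o]_2.
Proof.
have E : E00 *m E00 = E00 :> 'M[K^o]_2 by rewrite mul_delta_mx.
rewrite mulmxDl mulmxDr -!scalemxAl -!scalemxAr E mul_E10E00 mul_E00E10.
rewrite scaler0 addr0 [v *: E00 + _ - _]addrC addKr -addrA -scalerDl.
by congr (_ + _ *: _); ring.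
Qed.

End ModelAlgebra.

Section ModelGeneric.
Context {R : realType}.
Variable c : cplx R.
Implicit Types (x : cspace R 1).

Lemma is_diff_modelA x : is_diff x (modelA c)
  (fun v => v 0 0 *: E00 + (c * (2 * x 0 0 * v 0 0)) *: E10).
Proof.
have X := is_diff_coord x.
have Cst (k : cplx R) := @is_diff_funC R[i] (cspace R 1) (cplx R) k x.
have D := is_diff_funD (is_diff_funZ (E00 : cmx R 2) X)
  (is_diff_funZ (E10 : cmx R 2) (is_diff_funM (Cst c) (is_diff_funM X X))).
apply: (is_diff_conv D) => u /=; congr (_ + _ *: _).
by rewrite mul0r add0r -mulrA mulr_natl mulr2n (mulrC (u 0 0)).
Qed.

Lemma is_diff_modelC x (v : cspace R 1) : is_diff x (fun y => modelC c y v)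
  (fun u => (c * u 0 0 * v 0 0) *: E10).
Proof.
have X := is_diff_coord x.
have Cst (k : cplx R) := @is_diff_funC R[i] (cspace R 1) (cplx R) k x.
have D := is_diff_funD (is_diff_funC (v 0 0 *: E00 : cmx R 2) x)
  (is_diff_funZ (E10 : cmx R 2) (is_diff_funM (is_diff_funM (Cst c) X) (Cst (v 0 0)))).
apply: (is_diff_conv D) => u /=.
by rewrite mul0r !add0r mulr0 addr0.
Qed.

Lemma modelC_holo : holo_form [set: cspace R 1] (modelC c).
Proof.
split.
  move=> x _ a u v; rewrite /modelC !mxE.
  rewrite (@scale_E R[i]) (@add_E R[i]); congr (_ *: _ + _ *: _).
  by rewrite mulrDr mulrCA.
move=> v x _; exact: (@ex_diff _ _ _ _ _ _ _ (is_diff_modelC x v)).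
Qed.

Lemma model_normal_form : normal_form (d := model_def c) setT (modelA c) (modelC c).
Proof.
split.
- by split => //; exact: openT.
- split; [|exact: modelC_holo|].
    by move=> x _; exact: (@ex_diff _ _ _ _ _ _ _ (is_diff_modelA x)).
  by rewrite /modelA /= !mxE expr0n mulr0 !scale0r addr0.
- exists (fun _ _ => 1%:M); split; last by [].
  split.
  + by move=> i; exact: (@holo_unit1 R (wspace R 1) 2).
  + by move=> i j p _ _ _ /=; rewrite mul1mx.
  + move=> i p v _ _ _; rewrite (gauge1 (V := wspace R 1)) /cb_conn /=.
    by rewrite normal_matrix_model.
- move=> x _; split.
  + move=> u v; rewrite /dform.
    have Dv := congr1 (@^~ u) (@diff_val _ _ _ _ _ _ _ (is_diff_modelC x v)).
    have Du := congr1 (@^~ v) (@diff_val _ _ _ _ _ _ _ (is_diff_modelC x u)).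
    refine (etrans (congr2 (fun A B : cmx R 2 => A - B) Dv Du) _).
    by rewrite -scalerBl mulrAC subrr scale0r.
  + move=> u v; exact (@model_wedge_scalars R[i] (c * x 0 0) (u 0 0) (v 0 0)).
  + move=> v.
    refine (etrans _ (@model_wedge_scalars R[i] (c * x 0 0) (x 0 0) (v 0 0))).
    by rewrite /modelA /modelC expr2 mulrA.
  + move=> v.
    refine (etrans (congr1 (@^~ v) (@diff_val _ _ _ _ _ _ _ (is_diff_modelA x))) _).
    exact (@model_deriv_scalars R[i] c (x 0 0) (v 0 0)).
Qed.

Lemma holo_unit_low : holo_unit [set: cspace R 1] (fun x => low (c * x 0 0) : cmx R 2).
Proof.
split => x _; last exact: (@low_unit R[i]).
have X := is_diff_coord x.
have Cst (k : cplx R) := @is_diff_funC R[i] (cspace R 1) (cplx R) k x.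
have D := is_diff_funD (is_diff_funC (1%:M : cmx R 2) x)
  (is_diff_funZ (E10 : cmx R 2) (is_diff_funM (Cst c) X)).
exact: (@ex_diff _ _ _ _ _ _ _ D).
Qed.

Definition model_eigenvalue (i : 'I_2) (x : cspace R 1) : cplx R :=
  if i == 0 then x 0 0 else 0.

Lemma is_diff_model_eigenvalue i x : is_diff x (model_eigenvalue i)
  (fun v => if i == 0 then v 0 0 else 0).
Proof.
rewrite /model_eigenvalue; case: (i == 0); first exact: is_diff_coord.
exact: (@is_diff_funC R[i] (cspace R 1) (cplx R)).
Qed.

Lemma model_generic : generic_dtype (model_def c).
Proof.
exists setT, (modelA c), (modelC c); split; first exact: model_normal_form.
- exists (fun x => low (c * x 0 0)), model_eigenvalue; split.
  + exact: holo_unit_low.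
  + by move=> i x _; exact: (@ex_diff _ _ _ _ _ _ _ (is_diff_model_eigenvalue i x)).
  + move=> x _.
    refine (etrans _ (@scale_E00_diag R[i] (x 0 0))).
    refine (etrans _ (@low_conj R[i] (c * x 0 0) (x 0 0))).
    by rewrite /modelA expr2 mulrA.
  (* The eigenvalues are [x] and 0; on the unit tangent vector their differentials are 1 and 0. *)
  + move=> i j ij; exists (const_mx 1).
    have Di := congr1 (@^~ (const_mx 1)) (@diff_val _ _ _ _ _ _ _ (is_diff_model_eigenvalue i 0)).
    have Dj := congr1 (@^~ (const_mx 1)) (@diff_val _ _ _ _ _ _ _ (is_diff_model_eigenvalue j 0)).
    move: Di Dj => /= Di Dj; apply/eqP => E.
    have {E} := etrans (esym Di) (etrans E Dj); rewrite !mxE.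
    case: (unliftP ord0 i) ij => [i'|] ->; case: (unliftP ord0 j) => [j'|] -> //=.
    * by rewrite !ord1.
    * by move=> _ /esym/eqP; rewrite oner_eq0.
    * by move=> _ /eqP; rewrite oner_eq0.
- exists (fun x => low (c * x 0 0)); split; first exact: holo_unit_low.
  move=> x v _.
  have -> : invmx (low (c * x 0 0)) *m modelC c x v *m low (c * x 0 0) = v 0 0 *: E00.
    exact (@low_conj R[i] (c * x 0 0) (v 0 0)).
  by rewrite (@scale_E00_diag R[i]) diag_mx_is_diag.
Qed.

End ModelGeneric.

(** * Entries of two by two matrices and the gauge equation *)

Lemma mulmx2E (K : fieldType) (M N : 'M[K^o]_2) i j :
  (M *m N) i j = M i 0 * N 0 j + M i 1 * N 1 j.
Proof.
rewrite mxE big_ord_recl big_ord1; congr (_ + M i _ * N _ j); exact: val_inj.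
Qed.

Section MatrixCalculus.
Context {K : numFieldType} {V : normedModType K}.

Lemma is_diff_entry m n (F dF : V -> 'M[K^o]_(m, n)) p i j : is_diff p F dF ->
  is_diff p (fun q => F q i j : K^o) (fun u => dF u i j).
Proof.
move=> Fd.
have D : is_diff (F p) (fun M : 'M[K^o]_(m, n) => M i j : K^o) (fun M => M i j).
  apply: (@is_diff_linear_fun K _ K^o (fun M : 'M[K^o]_(m, n) => M i j)).
    by move=> k M N; rewrite !mxE.
  exact: coord_continuous.
exact: is_diff_comp Fd D.
Qed.

Lemma is_diff_mulmx2_entry (F dF G dG : V -> 'M[K^o]_2) p i j :
  is_diff p F dF -> is_diff p G dG ->
  is_diff p (fun q => (F q *m G q) i j : K^o) (fun u => (dF u *m G p + F p *m dG u) i j).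
Proof.
move=> Fd Gd.
have D := is_diff_funD
  (is_diff_funM (is_diff_entry i 0 Fd) (is_diff_entry 0 j Gd))
  (is_diff_funM (is_diff_entry i 1 Fd) (is_diff_entry 1 j Gd)).
rewrite (_ : (fun q => _) = (fun q => F q i 0 * G q 0 j + F q i 1 * G q 1 j)); last first.
  by apply/funext => q; rewrite mulmx2E.
apply: (is_diff_conv D) => u /=.
by rewrite mxE !mulmx2E addrACA.
Qed.

End MatrixCalculus.

Lemma is_diff_pairl (K : numFieldType) (V W : normedModType K) (y : W) (w : V) :
  is_diff w (fun t : V => (t, y)) (fun u => (u, 0)).
Proof. exact: (is_diff_pair (is_diff_id w) (is_diff_cst y w)). Qed.

Lemma is_diff_slice (K : numFieldType) (V W X : normedModType K) (f : V * W -> X)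
    (w : V) (y : W) : differentiable f (w, y) ->
  is_diff w (fun t => f (t, y)) (fun u => 'd f (w, y) (u, 0)).
Proof.
move=> /differentiableP fd; exact: (is_diff_comp (is_diff_pairl y w) fd).
Qed.

(** Each gauge relation is solved for its differential. In the product rule for [T *m s] the
    intermediate [om2], the connection in a local frame, cancels; only the two normal forms [om1]
    and [om3] remain. *)
Lemma gauge_comp (K : fieldType) (n : nat) (T s om1 om2 om3 dT ds : 'M[K]_n) :
  T \in unitmx -> s \in unitmx ->
  invmx T *m om1 *m T + invmx T *m dT = om2 ->
  invmx s *m om2 *m s + invmx s *m ds = om3 ->
  dT *m s + T *m ds = T *m s *m om3 - om1 *m (T *m s).
Proof.
move=> Tu su E2 E3.
have {}E2 : dT = T *m om2 - om1 *m T.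
  by rewrite -E2 mulmxDr !mulmxA mulmxV// !mul1mx addrC addKr.
have {}E3 : ds = s *m om3 - om2 *m s.
  by rewrite -E3 mulmxDr !mulmxA mulmxV// !mul1mx addrC addKr.
rewrite E2 E3 mulmxBl mulmxBr !mulmxA.
by rewrite addrC addrA subrK.
Qed.

(** On the tangent vector [(1, 0)] the polar part of the model is [A1 + w B0], so the entries of [M]
    are the right-hand sides required by [gauge_core]. *)
Lemma gauge_entries (K : fieldType) (G A2 : 'M[K^o]_2) (c w x : K^o) : A2 0 1 = 0 ->
  let M := G *m (A2 + w *: E00) - polar_mx c w x 1 0 *m G in
  [/\ M 0 0 = G 0 0 * (A2 0 0 - x) + G 0 1 * A2 1 0,
      M 0 1 = G 0 1 * (A2 1 1 - x - w),
      M 1 0 = G 1 0 * (A2 0 0 + w) + G 1 1 * A2 1 0 - c * x ^+ 2 * G 0 0 &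
      M 1 1 = G 1 1 * A2 1 1 - c * x ^+ 2 * G 0 1].
Proof.
move=> A0 /=.
have E i j (M N : 'M[K^o]_2) : (M - N) i j = M i j - N i j by rewrite !mxE.
have P00 : polar_mx c w x 1 0 0 0 = x + w.
  by rewrite !mxE /=; ring.
have P01 : polar_mx c w x 1 0 0 1 = 0.
  by rewrite !mxE /=; ring.
have P10 : polar_mx c w x 1 0 1 0 = c * x ^+ 2.
  by rewrite !mxE /=; ring.
have P11 : polar_mx c w x 1 0 1 1 = 0.
  by rewrite !mxE /=; ring.
have A00 : (A2 + w *: E00) 0 0 = A2 0 0 + w by rewrite !mxE /=; ring.
have A01 : (A2 + w *: E00) 0 1 = 0 by rewrite !mxE /= A0; ring.
have A10 : (A2 + w *: E00) 1 0 = A2 1 0 by rewrite !mxE /=; ring.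
have A11 : (A2 + w *: E00) 1 1 = A2 1 1 by rewrite !mxE /=; ring.
by split; rewrite E !mulmx2E ?P00 ?P01 ?P10 ?P11 ?A00 ?A01 ?A10 ?A11; ring.
Qed.

Lemma det_mx2 (K : fieldType) (M : 'M[K^o]_2) :
  \det M = M 0 0 * M 1 1 - M 0 1 * M 1 0.
Proof.
have e1 (i : 'I_1) : lift 0 i = 1 :> 'I_2 by rewrite (ord1 i); exact: val_inj.
have e2 (i : 'I_1) : lift 1 i = 0 :> 'I_2 by rewrite (ord1 i); exact: val_inj.
rewrite (expand_det_row _ 0) !big_ord_recl big_ord0 addr0 /cofactor !det_mx11 !mxE.
by rewrite !e1 !e2 /bump /= addn0 expr0 mul1r expr1 mulN1r mulrN.
Qed.

Lemma unitmx2 (K : fieldType) (M : 'M[K^o]_2) : M \in unitmx ->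
  M 0 0 * M 1 1 - M 0 1 * M 1 0 != 0.
Proof. by rewrite unitmxE unitfE det_mx2. Qed.

Lemma continuous_entry (K : numFieldType) (T : topologicalType) (V : normedModType K)
    m n (F : V -> 'M[K^o]_(m, n)) (p : T -> V) (t : T) i j :
  differentiable F (p t) -> {for t, continuous p} ->
  {for t, continuous (fun s => F (p s) i j : K^o)}.
Proof.
move=> Fd pc; apply: (@continuous_comp T V K^o p (fun q => F q i j)) => //.
have Hd := is_diff_entry i j (differentiableP Fd).
exact: (differentiable_continuous (@ex_diff _ _ _ _ _ _ _ Hd)).
Qed.

(** The last relation gives [T0 = Tt X / (X - k)], which is [o(X)] because [Tt] tends to 0 and
    [k != 0]. Substitution yields [b / X^2 = (c P - Tt / (X - k)) / S], which tends to [c]. *)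
Lemma lower_left_limit (K : numFieldType) (I : Type) (F : set_system I) {FF : ProperFilter F}
    (P S T0 Tt b X : I -> K) (c k : K) : k != 0 ->
  P @ F --> (1 : K) -> S @ F --> (1 : K) -> Tt @ F --> (0 : K) -> X @ F --> (0 : K) ->
  (\forall x \near F, X x != 0) ->
  (\forall x \near F, S x * b x = c * X x ^+ 2 * P x - X x * T0 x) ->
  (\forall x \near F, Tt x * X x = T0 x * (X x - k)) ->
  (fun x => b x / X x ^+ 2) @ F --> c.
Proof.
move=> k0 Pl Sl Tl Xl X0 E1 E2.
have Xkl : (fun x => X x - k) @ F --> 0 - k by apply: cvgB => //; exact: cvg_cst.
have nk0 : 0 - k != 0 by rewrite sub0r oppr_eq0.
have Ql : (fun x => (c * P x - Tt x / (X x - k)) / S x) @ F --> (c * 1 - 0 / (0 - k)) / 1.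
  apply: cvgM; last by apply: cvgV; [exact: oner_neq0 | exact: Sl].
  apply: cvgB; first by apply: cvgM; [exact: cvg_cst | exact: Pl].
  by apply: cvgM => //; exact: cvgV.
rewrite mul0r subr0 mulr1 divr1 in Ql.
apply: cvg_trans Ql; apply: near_eq_cvg; near=> x.
have X0' : X x != 0 by near: x.
have S0' : S x != 0 by near: x; apply: cvgr_neq0 Sl _; exact: oner_neq0.
have Xk0' : X x - k != 0 by near: x; apply: cvgr_neq0 Xkl _.
have E1' : S x * b x = c * X x ^+ 2 * P x - X x * T0 x by near: x.
have E2' : Tt x * X x = T0 x * (X x - k) by near: x.
have -> : b x = (c * X x ^+ 2 * P x - X x * T0 x) / S x by rewrite -E1' mulrC mulKf.
have -> : T0 x = Tt x * X x / (X x - k) by rewrite E2' mulfK.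
by field; rewrite X0' S0' Xk0'.
Unshelve. all: by end_near. Qed.

(** * Pulling back to the model *)

Lemma near_open_comp (T V : topologicalType) (f : T -> V) (O : set V) (x : T) : open O ->
  f @ x --> f x -> O (f x) -> \forall t \near x, O (f t).
Proof. by move=> Oo fc Of; apply: fc; exact: open_nbhs_nbhs. Qed.

Lemma cderiv_near (R : realType) (f g : R -> cplx R) (t : R) (l : cplx R) :
  (\forall s \near t, f s = g s) -> cderiv f t l -> cderiv g t l.
Proof.
move=> fg [fR fI]; split.
  by apply: near_eq_is_derive fR; near do (congr Re).
by apply: near_eq_is_derive fI; near do (congr Im).
Unshelve. all: by end_near. Qed.

Lemma pole2_model_scale (R : realType) (c k : cplx R) (w : cplx R) (x : cspace R 1) :
  pole2 (model_polar c) (w, x) (k, 0) = (w ^- 2 * k) *: polar_mx c w (x 0 0) 1 0.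
Proof.
rewrite /pole2 /model_polar /= mxE -scalerA; congr (_ *: _).
by rewrite -[RHS]addr0 -[X in _ + X](_ : polar_mx c w (x 0 0) 0 0 = 0) -?polar_mx_linear
  ?mulr1 ?mulr0 ?addr0// /polar_mx !mul0r !mulr0 subrr mulr0 !scale0r addr0.
Qed.

Section Pullback.
Context {R : realType} (c : cplx R) (d : int_deformation 0 (B0 : cmx R 2)).
Local Notation m := (id_dim d).
Variables (U : set (cspace R m)) (A : cspace R m -> cmx R 2)
  (C : cspace R m -> cspace R m -> cmx R 2)
  (s : cb_idx (id_E d) -> wspace R m -> cmx R 2).
Hypotheses (Uopen : open U) (UX : U `<=` id_X d) (Cholo : holo_form U C)
  (sbasis : basis_with_matrix (disc (id_r d) `*` U) s (normal_matrix B0 A C))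
  (sid : forall i w, cb_dom i (w, id_xo d) -> s i (w, id_xo d) = id_basis i w).
Variables (U' : set (cspace R 1)) (phi : cspace R 1 -> cspace R m)
  (T : cb_idx (id_E d) -> wspace R 1 -> cmx R 2).
Let dom (i : cb_idx (id_E d)) : set (wspace R 1) :=
  [set p | [/\ U' p.2, (disc 1 `*` [set: cspace R 1]) p & cb_dom i (base_change phi p)]].
Hypotheses (U'open : open U') (phiholo : holo U' phi) (phi0 : phi 0 = id_xo d)
  (Tholo : forall i, holo_unit (dom i) (T i))
  (Tcoc : forall i j p, dom i p -> dom j p ->
     T j p = T i p *m cb_trans i j (base_change phi p))
  (Tgauge : forall i p v, dom i p -> p.1 != 0 ->
     gauge (T i) (pole2 (model_polar c)) p v =
     cb_conn i (base_change phi p) (v.1, 'd phi (p.2) v.2))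
  (Tid : forall i w, dom i (w, 0) -> T i (w, 0) *m id_basis i w = 1%:M).

(** The model lives over the unit disc, [d] over a disc of radius [id_r d]; they are compared over
    the smaller one. *)
Let r : R := Num.min 1 (id_r d).

Let good (x : cspace R 1) : Prop := U' x /\ U (phi x).

Let r_gt0 : 0 < r. Proof. by rewrite lt_min ltr01 id_r_gt0. Qed.

Let disc_r (w : cplx R) : disc r w -> disc 1 w /\ disc (id_r d) w.
Proof.
by rewrite /disc /= => wr; split; apply: lt_le_trans wr _; rewrite lecR /r ge_min lexx ?orbT.
Qed.

Let sel_ex : exists sel : wspace R m -> cb_idx (id_E d),
  forall w y, disc r w -> U y -> cb_dom (sel (w, y)) (w, y).
Proof.
(* The choice function needs a value everywhere; [i0] is the default outside the product of [disc r]
   and [U]. *)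
have [i0 _] : exists i : cb_idx (id_E d), cb_dom i (0, id_xo d).
  have [cov _] := cb_cover (id_E d) (0, id_xo d).
  apply: cov; split; last exact: id_base.
  by rewrite /disc /= normr0 ltcR; exact: id_r_gt0.
have /choice[sel selP] p : exists i : cb_idx (id_E d), (disc r `*` U) p -> cb_dom i p.
  have [[wr yU]|h] := pselect ((disc r `*` U) p); last by exists i0.
  have [cov _] := cb_cover (id_E d) p.
  have [|i ip] := cov; last by exists i.
  by split; [exact: (disc_r wr).2 | exact: UX].
by exists sel => w y wr yU; exact: (selP (w, y)).
Qed.

(* [G w x] is the matrix of the isomorphism [phi^* E -> E'] in the two bases of
   normal form, so the right-hand side does not depend on the local frame [e_i]. *)
Definition transition_spec (G : cplx R -> cspace R 1 -> cmx R 2) : Prop :=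
  forall i w x, disc r w -> good x -> cb_dom i (w, phi x) ->
    G w x = T i (w, x) *m s i (w, phi x).

Let domP i w x : disc r w -> good x -> cb_dom i (w, phi x) -> dom i (w, x).
Proof. by move=> wr [xU _] iw; split => //; split => //; exact: (disc_r wr).1. Qed.

(** A change of frame multiplies [T i] on the right by the transition matrix, and that matrix times
    [s j] is [s i]. A pointwise choice of frames therefore gives a well-defined [G]. *)
Lemma transition_ex : exists G, transition_spec G.
Proof.
have [sel selP] := sel_ex.
exists (fun w x => T (sel (w, phi x)) (w, x) *m s (sel (w, phi x)) (w, phi x)).
move=> i w x wr xg iw; have [xU yU] := xg.
have jw := selP w (phi x) wr yU; set j := sel _ in jw *.
have [_ scoc _] := sbasis.
rewrite (Tcoc (domP wr xg iw) (domP wr xg jw)) -mulmxA scoc//.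
by split; [exact: (disc_r wr).2|].
Qed.

(** At the base point [s i] is [id_basis i], and [T i] respects the identifications with the fixed
    restriction, where the model has the identity basis. *)
Lemma transition_at_base G w : transition_spec G -> good 0 -> disc r w -> G w 0 = 1%:M.
Proof.
move=> GP g0 wr; have [sel selP] := sel_ex.
have jw := selP w (phi 0) wr g0.2.
rewrite (GP _ _ _ wr g0 jw); rewrite phi0 in jw *.
rewrite sid//; apply: Tid; apply: domP => //; by rewrite phi0.
Qed.

Lemma good_near0 : U (id_xo d) -> U' 0 ->
  \forall x \near (0 : cspace R 1), good x.
Proof.
move=> Uxo U'0; near=> x; split; near: x; first exact: open_nbhs_nbhs.
apply: (near_open_comp (f := phi)) => //; last by rewrite phi0.
exact: (differentiable_continuous (phiholo U'0)).
Unshelve. all: by end_near. Qed.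

(** The ray [w = i t] is written in the shape [p + t *: v] that [cderiv_line] differentiates. *)
Lemma wt_continuous : continuous (fun t : R => 0 + t%:C *: ('i%C : cplx R) : cplx R).
Proof. exact: (@line_continuous R (cplx R)). Qed.

Lemma disc_wt t : `|t| < r -> disc r (0 + t%:C *: ('i%C : cplx R)).
Proof.
move=> tr; rewrite /disc /= add0r normrZ normCR (normc_def 'i%C) /=.
by rewrite expr0n expr1n add0r sqrtr1 mulr1 ltcR.
Qed.

Lemma transition_deriv G x t0 : transition_spec G -> good x -> `|t0| < r ->
  let w t : cplx R := 0 + t%:C *: 'i%C in
  exists D : cmx R 2, [/\
    forall k l, cderiv (fun t => G (w t) x k l) t0 (D k l),
    forall k l, {for t0, continuous (fun t => G (w t) x k l : cplx R)} &
    w t0 != 0 -> D = (w t0 ^- 2 * 'i%C) *: (G (w t0) x *m (A (phi x) + w t0 *: B0)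
        - polar_mx c (w t0) (x 0 0) 1 0 *m G (w t0) x)].
Proof.
move=> GP xg tr w; have w0r : disc r (w t0) := disc_wt tr.
have [sel selP] := sel_ex.
have iw := selP (w t0) (phi x) w0r xg.2; set i := sel _ in iw.
have [shol _ sgauge] := sbasis.
have Td : differentiable (T i) (w t0, x) := (Tholo i).1 _ (domP w0r xg iw).
have Tu : T i (w t0, x) \in unitmx := (Tholo i).2 _ (domP w0r xg iw).
have sp : (disc (id_r d) `*` U) (w t0, phi x) := conj (disc_r w0r).2 xg.2.
have sd : differentiable (s i) (w t0, phi x) := (shol i).1 _ (conj iw sp).
have su : s i (w t0, phi x) \in unitmx := (shol i).2 _ (conj iw sp).
pose h k l (z : cplx R) := (T i (z, x) *m s i (z, phi x)) k l.
pose D : cmx R 2 := 'd (T i) (w t0, x) ('i%C : cplx R, 0 : cspace R 1) *m s i (w t0, phi x) +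
  T i (w t0, x) *m 'd (s i) (w t0, phi x) ('i%C : cplx R, 0 : cspace R m).
have hd k l := is_diff_mulmx2_entry k l (is_diff_slice Td) (is_diff_slice sd).
have hdiff k l : differentiable (h k l) (w t0) := @ex_diff _ _ _ _ _ _ _ (hd k l).
(* The frame chosen at [w t0] stays valid nearby because its domain is open, so one product of
   differentiable functions represents [G] around [t0]. *)
have hG : \forall t \near t0, forall k l, h k l (w t) = G (w t) x k l.
  have pc : (fun t => (w t, phi x) : wspace R m) @ t0 --> (w t0, phi x).
    have h1 : w @ t0 --> w t0 by exact: wt_continuous.
    have h2 : (fun _ : R => phi x) @ t0 --> phi x by exact: cvg_cst.
    exact: (cvg_pair h1 h2).
  have ni := near_open_comp (@cb_dom_open _ _ _ _ (id_E d) i) pc iw.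
  have nr : \forall t \near t0, disc r (w t).
    apply: (near_open_comp (f := w)) => //; last exact: wt_continuous.
    exact: (@open_norm_lt R[i] (cplx R)).
  near=> t => k l; rewrite (GP i)//; near: t; [exact: nr | exact: ni].
exists D; split.
- move=> k l; apply: (@cderiv_near _ (fun t => h k l (w t))).
    by near=> t; apply: (near hG t).
  have := cderiv_line (hdiff k l).
  by rewrite (congr1 (@^~ 'i%C) (@diff_val _ _ _ _ _ _ _ (hd k l))).
- move=> k l.
  have hc : (fun t => h k l (w t)) @ t0 --> h k l (w t0).
    apply: (@continuous_comp R (cplx R) (cplx R) w (h k l)); first exact: wt_continuous.
    exact: (differentiable_continuous (hdiff k l)).
  have E0 : h k l (w t0) = G (w t0) x k l := nbhs_singleton hG k l.
  change ((fun t => G (w t) x k l : cplx R) @ t0 --> (G (w t0) x k l : cplx R)).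
  rewrite -E0.
  apply: cvg_trans hc; apply: near_eq_cvg.
  by near=> t; apply: (near hG t).
- move=> w0.
  (* The tangent vector [(i, 0)] is the velocity of the ray. On it the pulled-back direction is
     again [(i, 0)] and [C] contributes 0, which leaves the [dw]-component. *)
  have E2 := Tgauge ('i%C : cplx R, 0 : cspace R 1) (domP w0r xg iw) w0.
  have E3 := sgauge i (w t0, phi x) ('i%C : cplx R, 0 : cspace R m) iw sp w0.
  rewrite /= linear0 in E2.
  have := gauge_comp Tu su E2 E3; rewrite -/D => ->.
  rewrite -(GP i _ _ w0r xg iw) pole2_model_scale.
  have C0 : C (phi x) 0 = 0.
    have := Cholo.1 _ xg.2 (-1) 0 0.
    by rewrite scaler0 addr0 scaleN1r addNr.
  rewrite /normal_matrix /= C0 scaler0 subr0 /dz scaleNr opprK.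
  by rewrite -scalemxAr -scalemxAl -scalerBr.
Unshelve. all: by end_near. Qed.

Let xe (x : R) : cspace R 1 := 0 + x%:C *: const_mx 1.

Let xeE x : xe x 0 0 = x%:C.
Proof. by rewrite /xe add0r !mxE mulr1. Qed.

Let w (t : R) : cplx R := 0 + t%:C *: 'i%C.

Let wE t : w t = 'i%C * t%:C.
Proof. by rewrite /w add0r mulrC. Qed.

Lemma transition_core G x : transition_spec G -> good (xe x) -> 0 < x ->
  A (phi (xe x)) 0 1 = 0 ->
  [/\ A (phi (xe x)) 0 0 = x%:C, A (phi (xe x)) 1 1 = 0,
    G (w 0) (xe x) 1 1 * A (phi (xe x)) 1 0 =
      c * x%:C ^+ 2 * G (w 0) (xe x) 0 0 - x%:C * G (w 0) (xe x) 1 0 &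
    forall t, 0 < t < r ->
      G (w t) (xe x) 1 0 * x%:C = G (w 0) (xe x) 1 0 * (x%:C - 'i%C * t%:C)].
Proof.
move=> GP xg x0 A01.
(* The derivatives found at the individual points of the ray are collected into one function, with
   value 0 outside [|t| < r]. *)
have [D DP] : exists D : R -> cmx R 2, forall t, `|t| < r -> [/\
    forall k l, cderiv (fun t => G (w t) (xe x) k l) t (D t k l),
    forall k l, {for t, continuous (fun t => G (w t) (xe x) k l : cplx R)} &
    w t != 0 -> D t = (w t ^- 2 * 'i%C) *: (G (w t) (xe x) *m (A (phi (xe x)) + w t *: B0)
        - polar_mx c (w t) (xe x 0 0) 1 0 *m G (w t) (xe x))].
  have [D DP] : {D & forall t, `|t| < r -> _} := choice (fun t =>
    match pselect (`|t| < r) with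
    | left tr => match transition_deriv GP xg tr with ex_intro D h => ex_intro _ D (fun _ => h) end
    | right ntr => ex_intro _ 0 (fun tr => False_ind _ (ntr tr))
    end).
  by exists D.
have rt t : 0 <= t < r -> `|t| < r by move=> /andP[t0 tr]; rewrite ger0_norm.
have r0 : `|0 : R| < r by rewrite normr0.
have [_ G0c _] := DP 0 r0.
have Dd k l t : 0 <= t < r -> cderiv (fun t => G (w t) (xe x) k l) t (D t k l).
  by move=> /rt/DP[h _ _]; exact: h.
have [sel selP] := sel_ex.
have w0r : disc r (w 0) by apply: disc_wt; rewrite normr0.
have det0 : G (w 0) (xe x) 0 0 * G (w 0) (xe x) 1 1 -
    G (w 0) (xe x) 0 1 * G (w 0) (xe x) 1 0 != 0.
  apply: (@unitmx2 R[i]).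
  have iw := selP (w 0) (phi (xe x)) w0r xg.2; set i := sel _ in iw.
  have [shol _ _] := sbasis.
  have sp : (disc (id_r d) `*` U) (w 0, phi (xe x)) := conj (disc_r w0r).2 xg.2.
  have Tu : T i (w 0, xe x) \in unitmx := (Tholo i).2 _ (domP w0r xg iw).
  have su : s i (w 0, phi (xe x)) \in unitmx := (shol i).2 _ (conj iw sp).
  by rewrite (GP i _ _ w0r xg iw) unitmx_mul Tu su.
have DE t : 0 < t < r -> let M := G (w t) (xe x) *m (A (phi (xe x)) + w t *: E00)
        - polar_mx c (w t) x%:C 1 0 *m G (w t) (xe x) in
    forall k l, 'i%C * (t ^+ 2)%:C * D t k l = M k l.
  move=> /andP[t0 tr] M k l.
  have [_ _ h] := DP t (rt t (introT andP (conj (ltW t0) tr))).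
  have wt0 : w t != 0.
    rewrite wE mulf_neq0//; first by rewrite eq_complex /= oner_eq0 andbF.
    by rewrite eq_complex /= eqxx andbT gt_eqF.
  rewrite h// xeE -/M mxE mulrA.
  (* For [w = i t] one has [w ^- 2 * i = - i / t^2], the inverse of [i t^2]. *)
  suff -> : 'i%C * (t ^+ 2)%:C * (w t ^- 2 * 'i%C) = 1 by rewrite mul1r.
  rewrite wE in wt0 *; rewrite rmorphXn /=.
  have t0' : t%:C != 0 :> cplx R by move: wt0; rewrite mulf_eq0 negb_or => /andP[].
  have i0 : 'i%C != 0 :> cplx R by move: wt0; rewrite mulf_eq0 negb_or => /andP[].
  transitivity ('i%C * (t%:C ^+ 2 * (t%:C ^+ 2)^-1) * (('i%C ^+ 2)^-1 * 'i%C) : cplx R).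
    by rewrite exprMn invfM; ring.
  rewrite divff ?expf_neq0// mulr1 mulrCA -expr2 mulVf// expf_neq0//.
have ent t (tr : 0 < t < r) := @gauge_entries R[i] (G (w t) (xe x)) _ c (w t) x%:C A01.
apply: (@gauge_core R x r c _ _ _ (fun t => G (w t) (xe x) 0 0) (fun t => G (w t) (xe x) 0 1)
  (fun t => G (w t) (xe x) 1 0) (fun t => G (w t) (xe x) 1 1)
  (fun t => D t 0 0) (fun t => D t 0 1) (fun t => D t 1 0) (fun t => D t 1 1) x0 r_gt0
  (Dd 0 0) (G0c 0 0) (Dd 0 1) (G0c 0 1) (Dd 1 0) (G0c 1 0) (Dd 1 1) (G0c 1 1) _ _ _ _ det0) => t tr.
- by rewrite (DE t tr 0 0); have [h _ _ _] := ent t tr; exact: h.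
- by rewrite (DE t tr 0 1) -wE; have [_ h _ _] := ent t tr; exact: h.
- by rewrite (DE t tr 1 0) -wE; have [_ _ h _] := ent t tr; exact: h.
- by rewrite (DE t tr 1 1); have [_ _ _ h] := ent t tr; exact: h.
Qed.

Hypotheses (Uxo : U (id_xo d)) (U'0 : U' 0)
  (A01 : \forall y \near id_xo d, A y 0 1 = 0).

Let xe0 : xe 0 = 0. Proof. by rewrite /xe rmorph0 scale0r addr0. Qed.

Let xe_continuous : {for 0, continuous xe}.
Proof. exact: (@line_continuous R (cspace R 1)). Qed.

Let phixe_continuous : {for 0, continuous (fun x => phi (xe x))}.
Proof.
apply: (@continuous_comp R (cspace R 1) (cspace R m) xe phi) => //.
rewrite xe0; exact: (differentiable_continuous (phiholo U'0)).
Qed.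

Let good_near (P : set (cspace R m)) : (\forall y \near id_xo d, P y) ->
  \forall x \near (0 : R), P (phi (xe x)).
Proof.
move=> nP; apply: phixe_continuous; rewrite /= xe0 phi0; exact: nP.
Qed.

Let good_xe : \forall x \near (0 : R), good (xe x).
Proof.
have h := good_near0 Uxo U'0; apply: xe_continuous; rewrite /= xe0; exact: h.
Qed.

(** Now [w] is fixed and [x] tends to 0. A single frame around [(w t, phi 0)] covers all small [x],
    where [G] is a product of continuous matrices with value the identity at the base point. *)
Lemma transition_cont G t k l : transition_spec G -> `|t| < r ->
  (fun x : R => G (w t) (xe x) k l : cplx R) @ (0 : R) --> ((1%:M : cmx R 2) k l : cplx R).
Proof.
move=> GP tr; have wr : disc r (w t) := disc_wt tr.
have g0 : good 0 by split => //; rewrite phi0.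
rewrite -(transition_at_base GP g0 wr).
have [sel selP] := sel_ex.
have iw := selP (w t) (phi 0) wr g0.2; set i := sel _ in iw.
have [shol _ _] := sbasis.
have sp : (disc (id_r d) `*` U) (w t, phi 0) := conj (disc_r wr).2 g0.2.
have Td : differentiable (T i) (w t, xe 0).
  by rewrite xe0; exact: ((Tholo i).1 _ (domP wr g0 iw)).
have sd : differentiable (s i) (w t, phi (xe 0)).
  by rewrite xe0; exact: ((shol i).1 _ (conj iw sp)).
have c1 : {for 0, continuous (fun x : R => (w t, xe x) : wspace R 1)}.
  have h1 : (fun _ : R => w t) @ (0 : R) --> w t by exact: cvg_cst.
  exact: (cvg_pair h1 xe_continuous).
have c2 : {for 0, continuous (fun x : R => (w t, phi (xe x)) : wspace R m)}.
  have h1 : (fun _ : R => w t) @ (0 : R) --> w t by exact: cvg_cst.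
  exact: (cvg_pair h1 phixe_continuous).
have cT a b := @continuous_entry R[i] R (wspace R 1) 2 2 (T i) _ 0 a b Td c1.
have cs a b := @continuous_entry R[i] R (wspace R m) 2 2 (s i) _ 0 a b sd c2.
have cc := @continuousD_at R[i] R _ _ 0 (@continuousM_at R[i] R _ _ 0 (cT k 0) (cs 0 l))
  (@continuousM_at R[i] R _ _ 0 (cT k 1) (cs 1 l)).
have E0 : G (w t) 0 k l = T i (w t, xe 0) k 0 * s i (w t, phi (xe 0)) 0 l
   + T i (w t, xe 0) k 1 * s i (w t, phi (xe 0)) 1 l.
  by rewrite xe0 (GP i _ _ wr g0 iw) (@mulmx2E R[i]).
rewrite E0; apply: cvg_trans cc; apply: near_eq_cvg.
have ni : \forall x \near (0 : R), cb_dom i (w t, phi (xe x)).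
  by apply: (near_open_comp (@cb_dom_open _ _ _ _ (id_E d) i) c2); rewrite xe0.
have n2 := good_xe; apply: filterS2 ni n2 => x ix xg.
exact (esym (etrans (congr1 (fun M : cmx R 2 => M k l) (GP i _ _ wr xg ix)) (@mulmx2E R[i] _ _ _ _))).
Unshelve. all: by end_near. Qed.

Lemma pullback_limit :
  (\forall x \near (0 : R)^'+, A (phi (xe x)) 0 0 = x%:C /\ A (phi (xe x)) 1 1 = 0) /\
  (fun x : R => A (phi (xe x)) 1 0 / x%:C ^+ 2 : cplx R) @ (0 : R)^'+ --> c.
Proof.
have [G GP] := transition_ex.
have nr (P : set R) : (\forall x \near (0 : R), P x) -> \forall x \near (0 : R)^'+, P x.
  exact: cvg_within.
have core : \forall x \near (0 : R)^'+,
    [/\ A (phi (xe x)) 0 0 = x%:C, A (phi (xe x)) 1 1 = 0,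
    G (w 0) (xe x) 1 1 * A (phi (xe x)) 1 0 =
      c * x%:C ^+ 2 * G (w 0) (xe x) 0 0 - x%:C * G (w 0) (xe x) 1 0 &
    forall t, 0 < t < r ->
      G (w t) (xe x) 1 0 * x%:C = G (w 0) (xe x) 1 0 * (x%:C - 'i%C * t%:C)].
  have n1 := nr _ good_xe; have n2 : \forall x \near (0 : R)^'+, 0 < x by exact: nbhs_right_gt.
  have n3 := nr _ (good_near A01).
  apply: filterS3 n1 n2 n3 => x xg x0 xA; exact: transition_core.
split; first by apply: filterS core => x [].
have r2 : 0 < r / 2 < r by have := r_gt0; lra.
have r2n : `|r / 2| < r by rewrite gtr0_norm; lra.
have r0n : `|0 : R| < r by rewrite normr0.
have right (f : R -> cplx R) (l : cplx R) : f @ (0 : R) --> l -> f @ (0 : R)^'+ --> l.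
  by move=> fl P /fl; exact: nr.
have e11 : (1%:M : cmx R 2) 1 1 = 1 by rewrite mxE.
have e00 : (1%:M : cmx R 2) 0 0 = 1 by rewrite mxE.
have e10 : (1%:M : cmx R 2) 1 0 = 0 by rewrite mxE.
have l1 := right _ _ (@transition_cont G 0 1 1 GP r0n).
have l2 := right _ _ (@transition_cont G 0 0 0 GP r0n).
(* The fixed nonzero [w] of the argument: [t = r / 2] lies inside the disc, and there the lower left
   entry of [G] tends to 0. *)
have l3 := right _ _ (@transition_cont G (r / 2) 1 0 GP r2n).
rewrite e11 in l1; rewrite e00 in l2; rewrite e10 in l3.
have l4 := right _ _ (@real_complex_continuous R 0).
apply: (@lower_left_limit R[i] R (0 : R)^'+ _ _ _ (fun x => G (w 0) (xe x) 1 0) _ _ _ c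
  ('i%C * (r / 2)%:C) _ l2 l1 l3 l4).
- rewrite mulf_neq0//; first by rewrite eq_complex /= oner_eq0 andbF.
  by rewrite eq_complex /= eqxx andbT gt_eqF//; case/andP: r2.
- have n2 : \forall x \near (0 : R)^'+, 0 < x by exact: nbhs_right_gt.
  apply: filterS n2 => x x0; rewrite eq_complex /= eqxx andbT gt_eqF//.
- by apply: filterS core => x [].
- by apply: filterS core => x [_ _ _]; apply.
Unshelve. all: by end_near. Qed.

End Pullback.

(** * The invariant ratio *)

(** The first equation reads entrywise [dA01 = 0], [dA00 = C00], [dA11 = C11], [dA10 = 2 C10].
    Inserted in the lower left entry of [[A, C] = 0], this gives [(a - d) db = 2 b d(a - d)]. *)
Lemma normal_form_entries (K : fieldType) (A C dA : 'M[K^o]_2) :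
  dA = C + (C *m E00 - E00 *m C) -> A *m C - C *m A = 0 ->
  dA 0 1 = 0 /\
  (A 0 1 = 0 -> (A 0 0 - A 1 1) * dA 1 0 = 2 * A 1 0 * (dA 0 0 - dA 1 1)).
Proof.
move=> EA AC.
have E i j (M N : 'M[K^o]_2) : (M - N) i j = M i j - N i j by rewrite !mxE.
have D i j (M N : 'M[K^o]_2) : (M + N) i j = M i j + N i j by rewrite !mxE.
have e00 : E00 0 0 = 1 :> K^o by rewrite mxE.
have e01 : E00 0 1 = 0 :> K^o by rewrite mxE.
have e10 : E00 1 0 = 0 :> K^o by rewrite mxE.
have e11 : E00 1 1 = 0 :> K^o by rewrite mxE.

have d01 : dA 0 1 = 0 by rewrite EA D E !mulmx2E ?e00 ?e01 ?e10 ?e11; ring.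
have d00 : dA 0 0 = C 0 0 by rewrite EA D E !mulmx2E ?e00 ?e01 ?e10 ?e11; ring.
have d11 : dA 1 1 = C 1 1 by rewrite EA D E !mulmx2E ?e00 ?e01 ?e10 ?e11; ring.
have d10 : dA 1 0 = 2 * C 1 0 by rewrite EA D E !mulmx2E ?e00 ?e01 ?e10 ?e11; ring.
split=> // A01; rewrite d00 d11 d10.
have AC10 : A 1 0 * C 0 0 + A 1 1 * C 1 0 - (C 1 0 * A 0 0 + C 1 1 * A 1 0) = 0.
  by have := congr1 (fun M : 'M[K^o]_2 => M 1 0) AC; rewrite E !mulmx2E !mxE.
apply/eqP; rewrite -subr_eq0; apply/eqP.
transitivity (- 2 * (A 1 0 * C 0 0 + A 1 1 * C 1 0 - (C 1 0 * A 0 0 + C 1 1 * A 1 0))).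
  by ring.
by rewrite AC10 mulr0.
Qed.

Lemma diff_near (K : numFieldType) (V W : normedModType K) (f : V -> W) (x : V) (e : K) :
  differentiable f x -> 0 < e ->
  \forall y \near x, `|f y - f x - 'd f x (y - x)| <= e * `|y - x|.
Proof.
move=> /diff_locally fd e0.
have /eqaddoP /(_ e e0) := fd.
rewrite (near_shift 0 x) => H.
apply: filterS H => z /=; rewrite subr0 /shift /= addrK.
by rewrite -[f _ - f x - _]addrA -opprD.
Qed.

(** At both ends [L] is within [X / 4] of [X], hence by convexity on the whole segment. Since [h] is
    within [X / 4] of [L], a zero of [h] would give [|X| <= X / 2]. *)
Lemma segment_nonzero (K : numFieldType) (V : normedModType K) (h : V -> K^o)
    (L : {linear V -> K^o}) (xo y0 y1 : V) (X e M t : K) :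
  0 < X -> 0 <= t -> t <= 1 -> 0 <= e -> e * M <= X / 4 ->
  `|y0 - xo| <= M -> `|y1 - xo| <= M -> h y0 = X -> h y1 = X ->
  (forall y, `|y - xo| <= M -> `|h y - L (y - xo)| <= e * `|y - xo|) ->
  `|y0 + t *: (y1 - y0) - xo| <= M /\ h (y0 + t *: (y1 - y0)) != 0.
Proof.
move=> X0 t0 t1 e0 eM y0M y1M h0 h1 hL.
have t10 : 0 <= 1 - t by rewrite subr_ge0.
set z := y0 + _.
have zE : z - xo = (1 - t) *: (y0 - xo) + t *: (y1 - xo).
  have -> : y1 - xo = (y1 - y0) + (y0 - xo) by rewrite addrA subrK.
  rewrite /z; move: (y1 - y0) => D.
  rewrite addrAC; move: (y0 - xo) => a.
  by rewrite scalerBl scale1r scalerDr [RHS]addrCA subrK addrC.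
have convM (a b m : K^o) : `|a| <= m -> `|b| <= m -> `|(1 - t) * a + t * b| <= m.
  move=> am bm; apply: (le_trans (ler_normD _ _)); rewrite !normrM (ger0_norm t10) (ger0_norm t0).
  have mE : m = (1 - t) * m + t * m by rewrite -mulrDl subrK mul1r.
  by rewrite [leRHS]mE; apply: lerD; apply: ler_wpM2l.
have zM : `|z - xo| <= M.
  rewrite zE; apply: (le_trans (ler_normD _ _)); rewrite !normrZ (ger0_norm t10) (ger0_norm t0).
  have ME : M = (1 - t) * M + t * M by rewrite -mulrDl subrK mul1r.
  by rewrite [leRHS]ME; apply: lerD; apply: ler_wpM2l.
split => //.
have b (y : V) : `|y - xo| <= M -> `|h y - L (y - xo)| <= X / 4.
  move=> yM; apply: le_trans (hL y yM) _; apply: le_trans eM.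
  by rewrite ler_wpM2l.
have bL : `|X - L (z - xo)| <= X / 4.
  have -> : X - L (z - xo) = (1 - t) * (h y0 - L (y0 - xo)) + t * (h y1 - L (y1 - xo)).
    have LE : L (z - xo) = (1 - t) * L (y0 - xo) + t * L (y1 - xo).
      by rewrite zE linearD !linearZ.
    by rewrite LE h0 h1; ring.
  by apply: convM; exact: b.
apply: contraL X0 => /eqP hz.
have := b z zM; rewrite hz sub0r normrN => bz.
have : `|X| <= X / 4 + X / 4.
  rewrite -[X in `|X|](subrK (L (z - xo))).
  by apply: (le_trans (ler_normD _ _)); rewrite lerD.
move=> XX; apply/negP => X0; move: XX; rewrite gtr0_norm//.
rewrite (_ : X / 4 + X / 4 = X / 2); last by field.
have X2 : X / 2 < X by rewrite ltr_pdivrMr// ltr_pMr// ltr1n.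
by move=> /le_lt_trans/(_ X2); rewrite ltxx.
Qed.

Lemma is_diff_funB (K : numFieldType) (V W : normedModType K) (f g df dg : V -> W) p :
  is_diff p f df -> is_diff p g dg ->
  is_diff p (fun q => f q - g q) (fun u => df u - dg u).
Proof. by move=> fd gd; exact: (is_diffB fd gd). Qed.

(** The numerator [db h - 2 b dh] is the combination that [normal_form_entries] shows to vanish. *)
Lemma is_diff_quot (K : numFieldType) (V : normedModType K) (b h db dh : V -> K^o) p :
  h p != 0 -> is_diff p b db -> is_diff p h dh ->
  is_diff p (fun q => b q / h q ^+ 2 : K^o)
    (fun u => (db u * h p - 2 * b p * dh u) / h p ^+ 3 : K^o).
Proof.
move=> hp bd hd.
have V1 := is_diff_funV hp hd.
have D := is_diff_funM bd (is_diff_funM V1 V1).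
rewrite (_ : (fun q => _) = (fun q => b q * ((h q)^-1 * (h q)^-1))); last first.
  by apply/funext => q; rewrite expr2 invfM.
apply: (is_diff_conv D) => u /=.
by field.
Qed.

Section Geometry.
Context {R : realType} {m : nat}.
Variables (xo : cspace R m) (U : set (cspace R m)) (A : cspace R m -> cmx R 2)
  (C : cspace R m -> cspace R m -> cmx R 2).
Hypotheses (Uopen : open U) (Uxo : U xo) (Aholo : holo U A) (Axo : A xo = 0)
  (AC : forall x, U x -> forall v, A x *m C x v - C x v *m A x = 0)
  (dA : forall x, U x -> forall v, 'd A x v = C x v + (C x v *m B0 - B0 *m C x v)).

Let dA_entry x i j : U x ->
  is_diff x (fun y => A y i j : cplx R) (fun v => 'd A x v i j).
Proof. by move=> xU; exact: (is_diff_entry i j (differentiableP (Aholo xU))). Qed.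

Let entries x v : U x -> 'd A x v 0 1 = 0 /\
  (A x 0 1 = 0 -> (A x 0 0 - A x 1 1) * 'd A x v 1 0 =
    2 * A x 1 0 * ('d A x v 0 0 - 'd A x v 1 1)).
Proof. by move=> xU; exact (@normal_form_entries R[i] _ _ _ (dA xU v) (AC xU v)). Qed.

Lemma segment_constant (f : cspace R m -> cplx R) (y0 y1 : cspace R m) :
  (forall t : R, 0 <= t <= 1 -> let z := y0 + t%:C *: (y1 - y0) in
     differentiable f z /\ 'd f z (y1 - y0) = 0) -> f y0 = f y1.
Proof.
move=> fd.
have e0 : y0 + (0 : R)%:C *: (y1 - y0) = y0 by rewrite rmorph0 scale0r addr0.
have e1 : y0 + (1 : R)%:C *: (y1 - y0) = y1 by rewrite rmorph1 scale1r addrC subrK.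
rewrite -[in LHS]e0 -[in RHS]e1.
apply: (@cderiv0_segment R (fun t => f (y0 + t%:C *: (y1 - y0))) 0 1 ler01) => t t01.
by have [fz dz] := fd t t01; have := cderiv_line fz; rewrite dz.
Qed.

Lemma near_norm (P : set (cspace R m)) : (\forall y \near xo, P y) ->
  exists2 e : R[i], 0 < e & forall y, `|y - xo| < e -> P y.
Proof.
move=> /nbhs_ballP[e e0 eP]; exists e => // y ye; apply: eP.
by rewrite -ball_normE /ball_ /= distrC.
Qed.

Lemma segment_norm (y : cspace R m) (t : R) : 0 <= t <= 1 ->
  `|xo + t%:C *: (y - xo) - xo| <= `|y - xo|.
Proof.
move=> /andP[t0 t1]; rewrite addrC addKr normrZ normCR ger0_norm//.
by rewrite ler_piMl// -(rmorph1 (real_complex R)) lecR.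
Qed.

(** The entry has zero differential on [U] and value 0 at [xo], so it vanishes along every segment
    from [xo] inside a ball. *)
Lemma upper_right_zero : \forall y \near xo, A y 0 1 = 0.
Proof.
have [e e0 eU] := near_norm (open_nbhs_nbhs (conj Uopen Uxo)).
have n : \forall y \near xo, `|xo - y| < e by exact: near_dist.
apply: filterS n => y; rewrite distrC => ye.
have <- : A xo 0 1 = 0 by rewrite Axo mxE.
apply/esym; apply: (@segment_constant (fun z => A z 0 1)) => t t01 z.
have zU : U z by apply: eU; apply: le_lt_trans ye; exact: segment_norm.
have D := dA_entry 0 1 zU.
split; first exact: (@ex_diff _ _ _ _ _ _ _ D).
by rewrite (congr1 (@^~ (y - xo)) (@diff_val _ _ _ _ _ _ _ D)); case: (entries (y - xo) zU).
Qed.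

Let h (y : cspace R m) : cplx R := A y 0 0 - A y 1 1.

Let dh x : U x -> is_diff x h (fun v => 'd A x v 0 0 - 'd A x v 1 1).
Proof.
move=> xU; exact: (is_diff_funB (dA_entry 0 0 xU) (dA_entry 1 1 xU)).
Qed.

Lemma ratio_constant y0 y1 :
  (forall t : R, 0 <= t <= 1 -> let z := y0 + t%:C *: (y1 - y0) in
     [/\ U z, A z 0 1 = 0 & h z != 0]) ->
  A y0 1 0 / h y0 ^+ 2 = A y1 1 0 / h y1 ^+ 2.
Proof.
move=> seg.
apply: (@segment_constant (fun z => A z 1 0 / h z ^+ 2)) => t t01 z.
have [zU z01 hz] := seg t t01.
have D := is_diff_quot hz (dA_entry 1 0 zU) (dh zU).
split; first exact: (@ex_diff _ _ _ _ _ _ _ D).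
refine (etrans (congr1 (@^~ (y1 - y0)) (@diff_val _ _ _ _ _ _ _ D)) _).
have [_ /(_ z01) E] := entries (y1 - y0) zU.
have E' : 'd A z (y1 - y0) 1 0 * h z -
    2 * A z 1 0 * ('d A z (y1 - y0) 0 0 - 'd A z (y1 - y0) 1 1) = 0.
  by rewrite mulrC; apply/eqP; rewrite subr_eq0; apply/eqP; exact: E.
exact (etrans (congr1 (fun u : cplx R => u / h z ^+ 3) E') (mul0r _)).
Qed.

(* On the segment from [g0 x] to [g1 x] one has [h = x + o(x)], so [h] does not
   vanish there and [ratio_constant] applies. *)
Lemma limits_agree (g0 g1 : R -> cspace R m) (c0 c1 K : cplx R) : 0 < K ->
  (\forall x \near (0 : R)^'+, `|g0 x - xo| <= K * x%:C) ->
  (\forall x \near (0 : R)^'+, `|g1 x - xo| <= K * x%:C) ->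
  (\forall x \near (0 : R)^'+, A (g0 x) 0 0 = x%:C /\ A (g0 x) 1 1 = 0) ->
  (\forall x \near (0 : R)^'+, A (g1 x) 0 0 = x%:C /\ A (g1 x) 1 1 = 0) ->
  (fun x : R => A (g0 x) 1 0 / x%:C ^+ 2 : cplx R) @ (0 : R)^'+ --> c0 ->
  (fun x : R => A (g1 x) 1 0 / x%:C ^+ 2 : cplx R) @ (0 : R)^'+ --> c1 ->
  c0 = c1.
Proof.
move=> K0 g0K g1K A0 A1 l0 l1.
(* Chosen so that within distance [K x] of [xo] the error of linearizing [h] is at most [x / 4], as
   [segment_nonzero] requires. *)
have e0 : 0 < (4 * K)^-1 by rewrite invr_gt0 mulr_gt0.
have hd : differentiable h xo := @ex_diff _ _ _ _ _ _ _ (dh Uxo).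
have n1 := diff_near hd e0.
have hxo : h xo = 0 by rewrite /h Axo !mxE subrr.
have [d d0 dP] : exists2 d : R[i], 0 < d & forall y, `|y - xo| < d ->
    [/\ U y, A y 0 1 = 0 & `|h y - 'd h xo (y - xo)| <= (4 * K)^-1 * `|y - xo|].
  apply: near_norm; have n2 := upper_right_zero.
  have n3 := open_nbhs_nbhs (conj Uopen Uxo).
  by apply: filterS3 n1 n2 n3 => y; rewrite hxo subr0.
have nK : \forall x \near (0 : R)^'+, K * x%:C < d.
  have n4 : \forall x \near (0 : R), `|x%:C : cplx R| < d / K.
    apply: (near_open_comp (@open_norm_lt R[i] (cplx R) (d / K))).
      exact: real_complex_continuous.
    by rewrite /= normr0 divr_gt0.
  have n5 : \forall x \near (0 : R)^'+, `|x%:C : cplx R| < d / K by exact: cvg_within.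
  apply: filterS n5 => x; rewrite ltr_pdivlMr// mulrC; apply: le_lt_trans.
  by rewrite ler_pM2l// real_ler_norm// complex_real.
have x0 : \forall x \near (0 : R)^'+, 0 < x by exact: nbhs_right_gt.
have same : \forall x \near (0 : R)^'+, A (g1 x) 1 0 / x%:C ^+ 2 = A (g0 x) 1 0 / x%:C ^+ 2.
  near=> x.
  have gK0 : `|g0 x - xo| <= K * x%:C by near: x.
  have gK1 : `|g1 x - xo| <= K * x%:C by near: x.
  have xp : 0 < x by near: x.
  have Kd : K * x%:C < d by near: x.
  have [A00 A01] : A (g0 x) 0 0 = x%:C /\ A (g0 x) 1 1 = 0 by near: x.
  have [A10 A11] : A (g1 x) 0 0 = x%:C /\ A (g1 x) 1 1 = 0 by near: x.
  have h0 : h (g0 x) = x%:C by rewrite /h A00 A01 subr0.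
  have h1 : h (g1 x) = x%:C by rewrite /h A10 A11 subr0.
  rewrite -{1}h1 -h0; apply/esym/ratio_constant => t /andP[t0 t1] z.
  have a1 : 0 < x%:C by rewrite ltcR.
  have a2 : 0 <= t%:C by rewrite lecR.
  have a3 : t%:C <= 1 by rewrite -(rmorph1 (real_complex R)) lecR.
  have a4 : (4 * K)^-1 * (K * x%:C) <= x%:C / 4.
    by rewrite invfM -mulrA mulKf ?gt_eqF// mulrC.
  have a5 y : `|y - xo| <= K * x%:C -> `|h y - 'd h xo (y - xo)| <= (4 * K)^-1 * `|y - xo|.
    by move=> yM; have [] := dP y (le_lt_trans yM Kd).
  have [zM hz] := @segment_nonzero R[i] (cspace R m) h ('d h xo) xo (g0 x) (g1 x)
    x%:C (4 * K)^-1 (K * x%:C) t%:C a1 a2 a3 (ltW e0) a4 gK0 gK1 h0 h1 a5.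
  by have [zU z01 _] := dP _ (le_lt_trans zM Kd).
apply: (@norm_cvg_unique _ (cplx R) _ _ _ _ l0).
apply: cvg_trans l1; apply: near_eq_cvg; exact: same.
Unshelve. all: by end_near. Qed.

End Geometry.

Lemma differentiable_line_bound (R : realType) (V W : normedModType R[i]) (f : V -> W) (u : V) :
  differentiable f 0 -> exists2 K : R[i], 0 < K &
  \forall x \near (0 : R)^'+, `|f (0 + x%:C *: u) - f 0| <= K * x%:C.
Proof.
(* The remainder is at most [x |u|] and the linear part [x |df u|]; the summand 1 makes the constant
   positive. *)
move=> fd; exists (`|u| + `|'d f 0 u| + 1); first by rewrite ltr_wpDl// addr_ge0.
have n1 := diff_near fd ltr01.
have n2 : \forall x \near (0 : R), 
    `|f (0 + x%:C *: u) - f 0 - 'd f 0 (0 + x%:C *: u - 0)| <= 1 * `|0 + x%:C *: u - 0|.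
  have cu := @line_continuous R V 0 u 0; rewrite /continuous_at rmorph0 scale0r addr0 in cu.
  exact: (cu _ n1).
have n3 : \forall x \near (0 : R)^'+,
    `|f (0 + x%:C *: u) - f 0 - 'd f 0 (0 + x%:C *: u - 0)| <= 1 * `|0 + x%:C *: u - 0|.
  exact: cvg_within.
have n4 : \forall x \near (0 : R)^'+, 0 < x by exact: nbhs_right_gt.
apply: filterS2 n3 n4 => x; rewrite mul1r subr0 add0r linearZ /= => fx x0.
have xp : 0 <= x%:C :> R[i] by rewrite lecR ltW.
rewrite -[X in `|X|](subrK (x%:C *: 'd f 0 u)).
apply: (le_trans (ler_normD _ _)).
apply: (@le_trans _ _ (`|x%:C *: u| + `|x%:C *: 'd f 0 u|)); first by rewrite lerD2r.
rewrite !normrZ (ger0_norm xp) -mulrDr mulrC ler_wpM2r//.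
by rewrite lerDl.
Qed.

(** * The contradiction between the constants 0 and 1 *)

Section Conclusion.
Context {R : realType}.

(** The path is the base change along the positive real axis. It transports the constant [c] of the
    model into a limit computed with the normal form of [d]. *)
Lemma induced_model_path (c : cplx R) (d : int_deformation 0 (B0 : cmx R 2))
    (U : set (cspace R (id_dim d))) A C : normal_form U A C ->
  induced (model_def c) d -> exists g : R -> cspace R (id_dim d), exists K : cplx R,
  [/\ 0 < K, \forall x \near (0 : R)^'+, `|g x - id_xo d| <= K * x%:C,
    \forall x \near (0 : R)^'+, A (g x) 0 0 = x%:C /\ A (g x) 1 1 = 0 &
    (fun x : R => A (g x) 1 0 / x%:C ^+ 2 : cplx R) @ (0 : R)^'+ --> c].
Proof.
move=> [[Uo Uxo UX] [Ah Ch Axo] [s [sb sid]] eqs].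
have A01 : \forall y \near id_xo d, A y 0 1 = 0.
  apply: (@upper_right_zero R (id_dim d) (id_xo d) U A C Uo Uxo Ah Axo).
    by move=> x /eqs[].
  by move=> x /eqs[].
move=> [U' [phi [T [[U'o U'0 _] [phih phi0 _] [Th Tc] Tg Tid]]]].
have [K K0 KP] := differentiable_line_bound (const_mx 1) (phih _ U'0).
have [|||nA lA] := @pullback_limit R c d U A C s Uo UX Ch sb sid U' phi (T tt) U'o phih phi0
  (Th tt) _ _ _ Uxo U'0 A01.
- by move=> i j p ip jp; rewrite (Tc tt tt i j p ip jp) mul1mx.
- by move=> i p v ip p0; exact: Tg.
- by move=> i w iw; exact: Tid.
exists (fun x => phi (0 + x%:C *: const_mx 1)), K; split => //.
by rewrite -phi0.
Qed.

Lemma no_versal : ~ exists d : int_deformation 0 (B0 : cmx R 2),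
  versal (@generic_dtype R 2 0 B0) d.
Proof.
(* One normal form of [d] is fixed for both base changes, so both limits concern the same [A]. *)
move=> [d [[U [A [C [NF _ _]]]] ver]].
have [g0 [K0 [K00 g0K A0 l0]]] := induced_model_path NF (ver _ (model_generic 0)).
have [g1 [K1 [K10 g1K A1 l1]]] := induced_model_path NF (ver _ (model_generic 1)).
move: NF => [[Uo Uxo UX] [Ah Ch Axo] _ eqs].
have x0 : \forall x \near (0 : R)^'+, 0 < x by exact: nbhs_right_gt.
(* [limits_agree] asks for a common constant in the two distance bounds; the sum [K0 + K1] is
   used. *)
have wk (k0 k1 : R[i]) (g : R -> cspace R (id_dim d)) : 0 <= k1 ->
    (\forall x \near (0 : R)^'+, `|g x - id_xo d| <= k0 * x%:C) ->
    \forall x \near (0 : R)^'+, `|g x - id_xo d| <= (k0 + k1) * x%:C.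
  move=> k10 gk; apply: filterS2 gk x0 => x gx xp; apply: (le_trans gx).
  by rewrite ler_wpM2r ?lerDl// lecR ltW.
have g0K' := wk _ K1 _ (ltW K10) g0K.
have g1K' := wk _ K0 _ (ltW K00) g1K; rewrite addrC in g1K'.
have AC x : U x -> forall v, A x *m C x v - C x v *m A x = 0 by move=> /eqs[].
have dA x : U x -> forall v, 'd A x v = C x v + (C x v *m B0 - B0 *m C x v).
  by move=> /eqs[].
have /esym/eqP : 0 = 1 :> cplx R := limits_agree Uo Uxo Ah Axo AC dA
  (addr_gt0 K00 K10) g0K' g1K' A0 A1 l0 l1.
by rewrite oner_eq0.
Qed.

End Conclusion.

Theorem mainTheorem6 (R : realType) (Ao Bo : cmx R 2)
    (hAo : Ao = 0)
    (hBo : Bo = \matrix_(i, j) (if (i == 0) && (j == 0) then 1 else 0)) :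
  ~ exists d : int_deformation Ao Bo, versal (@generic_dtype R 2 Ao Bo) d.
Proof.
have BoE : Bo = B0 by rewrite hBo; apply/matrixP => i j; rewrite !mxE; case: ifP.
move: BoE; clear hBo => BoE; subst Ao Bo; exact: no_versal.
Qed.
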